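(* Let $1\le s\le n$ and let $s$ algebraic hypersurfaces without multiple factors $f_1(X)=0,\dots,f_s(X)=0$ in $\mathbb{C}^n$, of degrees $k_1,\dots,k_s$ respectively, sufficiently intersect at the algebraic manifold $S_{n-s}=s(f_1,\dots,f_s)$. Let $m$ be a nonnegative integer. Then there exists a properly posed set of nodes (PPSN) of degree $m$ for Lagrange interpolation along $S_{n-s}$ (which contains $e_m^{(n)}(k_1,\dots,k_s)=\sum_{j=0}^m h_j(s)$ points).
   Context: $X=(x_1,\dots,x_n)$. $\mathbb{P}_m^{(n)}$ is the complex vector space of polynomials in $\mathbb{C}[x_1,\dots,x_n]$ of total degree $\le m$. $s(f_1,\dots,f_s)$ is the set of common zeros of $f_1,\dots,f_s$ in $\mathbb{C}^n$. A hypersurface $f(X)=0$ is without multiple factors if $f$ has no repeated non-constant factor. Sufficient intersection: hypersurfaces $f_1=0,\dots,f_s=0$ of degrees $k_1,\dots,k_s$ in $\mathbb{C}^n$ ($1\le s\le n$) sufficiently intersect at $s(f_1,\dots,f_s)$ if there exist $n-s$ hypersurfaces $f_{s+1}=0,\dots,f_n=0$ of degrees $k_{s+1},\dots,k_n$ such that $f_1=0,\dots,f_n=0$ meet exactly at $k_1\cdots k_n$ mutually distinct points of $\mathbb{C}^n$. $h_j(s)$ denotes the coefficient of $t^j$ in the expansion of $(1-t^{k_1})\cdots(1-t^{k_s})(1-t)^{-n}$. For every integer $m$, $e_m^{(n)}=\binom{m+n}{n}$, with $e_m^{(n)}=0$ for $m<0$. With $\nabla_k u_m=u_m-u_{m-k}$,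 put $e_m^{(n)}(k_1,\dots,k_s)=\nabla_{k_s}\cdots\nabla_{k_1}e_m^{(n)}$. PPSN: a set $\{Q^{(i)}\}$ of exactly $e_m^{(n)}(k_1,\dots,k_s)$ distinct points on $S=s(f_1,\dots,f_s)$ is a PPSN for Lagrange interpolation of degree $m$ along $S$ if for every set of complex numbers $\{q_i\}_{i=1}^{e_m^{(n)}(k_1,\dots,k_s)}$ there exists $f\in\mathbb{P}_m^{(n)}$ with $f(Q^{(i)})=q_i$ for all $i$. *)

(* Defs.v *)
From HB Require Import structures.
From mathcomp Require Import all_boot all_order all_algebra.
From mathcomp Require Import boolp classical_sets functions cardinality reals.
From mathcomp Require Import complex.
From mathcomp Require Import mpoly.

Set Implicit Arguments.
Unset Strict Implicit.
Unset Printing Implicit Defensive.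

Import Order.TTheory GRing.Theory Num.Theory.
Local Open Scope ring_scope.
Local Open Scope classical_set_scope.

(* The field of complex numbers is [R[i]] for [R : realType]; points of C^n are
   row vectors. *)

Section Hypersurfaces.
Variables (R : realType) (n : nat).
Local Notation C := R[i].

(* [msize p] is one plus the total degree of [p], and [0] if [p = 0]. *)
Definition poly_deg_le (m : nat) : set {mpoly C[n]} :=
  [set p | (msize p <= m.+1)%N].

(* A hypersurface is given by a nonconstant polynomial.  Positivity of [k] must
   not be dropped: a nonzero constant among the added hypersurfaces would make
   [sufficiently_intersect] hold for every family. *)
Definition hypersurface_of_degree (p : {mpoly C[n]}) (k : nat) : Prop :=
  (0 < k)%N /\ msize p = k.+1.

Definition without_multiple_factors (p : {mpoly C[n]}) : Prop :=
  forall g h : {mpoly C[n]}, p = g ^+ 2 * h -> exists c : C, g = c%:MP_[n].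

Definition common_zeros (F : seq {mpoly C[n]}) : set 'rV[C]_n :=
  [set x | forall p, p \in F -> p.@[x ord0] = 0].

Definition sufficiently_intersect (s : nat) (f : s.-tuple {mpoly C[n]})
    (k : s.-tuple nat) : Prop :=
  exists (g : (n - s).-tuple {mpoly C[n]}) (l : (n - s).-tuple nat),
    (forall i, hypersurface_of_degree (tnth g i) (tnth l i)) /\
    (common_zeros (f ++ g) #= `I_(\prod_(d <- k ++ l) d)%N)%card.

End Hypersurfaces.

Definition nabla (k : nat) (u : int -> int) : int -> int :=
  fun m => u m - u (m - k%:Z).

Definition e_num (n : nat) (m : int) : int :=
  if m is Posz a then ('C(a + n, n))%:Z else 0.

(* [nabla k_s (... (nabla k_1 (e_num n)))] evaluated at [m]. *)
Definition e_along (n : nat) (k : seq nat) (m : int) : int :=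
  foldl (fun u d => nabla d u) (e_num n) k m.

(* Formal power series in t over the integers, as sequences of coefficients. *)
Definition series_one : nat -> int := fun j => (j == 0%N)%:R.

Definition series_mul (a b : nat -> int) : nat -> int :=
  fun j => \sum_(i < j.+1) a i * b (j - i)%N.

Definition poly_series (p : {poly int}) : nat -> int := fun j => p`_j.

(* (1 - t)^{-1}, see [geometricP]. *)
Definition geometric : nat -> int := fun=> 1.

Lemma geometricP : series_mul (poly_series (1 - 'X)) geometric = series_one.
Proof.
apply/funext => -[|j]; rewrite /series_mul /poly_series /geometric /series_one.
  by rewrite big_ord1 coefB coef1 coefX.
rewrite 2!big_ord_recl big1 => [|i _]; by rewrite !coefB !coef1 !coefX.
Qed.

(* Coefficient of t^j in (1 - t^{k_1}) ... (1 - t^{k_s}) (1 - t)^{-n}. *)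
Definition h_coef (n : nat) (k : seq nat) (j : nat) : int :=
  series_mul (poly_series (\prod_(d <- k) (1 - 'X^d)))
             (iter n (series_mul geometric) series_one) j.

(* The set of nodes is enumerated without repetition by [Q]. *)
Definition PPSN (R : realType) (n s : nat) (f : s.-tuple {mpoly R[i][n]})
    (k : s.-tuple nat) (m N : nat) (Q : 'I_N -> 'rV[R[i]]_n) : Prop :=
  [/\ N%:Z = e_along n k m%:Z,
      injective Q,
      forall i, common_zeros f (Q i) &
      forall q : 'I_N -> R[i], exists2 p : {mpoly R[i][n]},
        poly_deg_le m p & forall i, p.@[Q i ord0] = q i].

(* Main.v *)
Require Import Defs.
From mathcomp Require Import all_boot all_order all_algebra.
From mathcomp Require Import boolp classical_sets functions cardinality reals.
From mathcomp Require Import complex.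
From mathcomp Require Import mpoly.
From mathcomp Require Import ring zify.
From mathcomp Require constructive_ereal lebesgue_measure.

(** Write [A] for the polynomial ring in [n] variables over [K = R[i]], [P_m] for
    its elements of degree at most [m], [J_j] for the ideal of the first [j] of
    the [n] equations [f_1, ..., f_n] of degrees [k_1, ..., k_n] that have exactly
    [D = k_1 ... k_n] common zeros, and [S_j] for the zero set of [J_j].  The
    restrictions of [P_m] to [S_s] form a space of functions whose dimension [e]
    is the largest number of points of [S_s] at which values may be prescribed,
    and [e] points with this property exist ([separating_points]).  So it
    suffices to prove that this dimension is [e_m(k_1, ..., k_s)].

    The dimension of [P_m / (J_s inter P_m)] is [e_m(k_1, ..., k_s)] as soon as
    the leading forms of [f_1, ..., f_s] are a regular sequence: leading terms of
    a combination can then be cancelled without raising degrees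
    ([lower_multiplier]), and each equation applies one difference operator to
    the Hilbert function ([codim_gen]).  It remains to see that the leading forms
    of [f_1, ..., f_n] are a regular sequence and that [J_s] contains every
    polynomial that vanishes on [S_s].

    Regularity.  The leading forms have no common zero but the origin
    ([top_forms_sop]).  Indeed, let [b_t] take the value 1 at the zero number [t]
    and 0 at the others.  The products [f^a b_t] are linearly independent
    ([fpow_indep]), because at an isolated zero the [f_i] satisfy no homogeneous
    relation with a unit among its coefficients ([quasi_regular]): otherwise the
    powers of the maximal ideal would have too small a colength.  As there are
    [D] functions [b_t], the independent products of degree at most [M] fill
    [P_M] up to a number of dimensions of order [M^(n-1)].  A common zero [v] of
    the leading forms would bound the degrees of all these products in the
    direction [v] away from [M], which leaves out about [M^n] dimensions.

    Forms [F_1, ..., F_n] without common zero but the origin are a regular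
    sequence ([sop_regular]).  This holds for the variables, and it is carried
    from one such system to another by exchanging one form at a time
    ([nzd_exchange], by a comparison of dimensions in large degrees), through
    systems found in pencils ([common_parameter]).

    Radicality.  [P_m / (J_n inter P_m)] has dimension at most [D], while vanishing
    at [D] points imposes [D] independent conditions in large degree; hence [J_n]
    is the ideal of its zero set.  Descending from [J_(j+1)] to [J_j], a
    polynomial [g] that vanishes on [S_j] is [z f_(j+1)] modulo [J_j] with [z] of
    smaller degree, and [z] vanishes on [S_j] because [f_(j+1)] is not a zero
    divisor modulo [J_j] ([radical_tail]).

    The Nullstellensatz, used throughout to pass from zeros to powers in ideals,
    is proved one variable at a time from the uncountability of [K]
    ([nullstellensatz_step]). *)

Set Implicit Arguments.
Unset Strict Implicit.
Unset Printing Implicit Defensive.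

Import Order.TTheory GRing.Theory Num.Theory.
Local Open Scope ring_scope.

(** * Linear algebra modulo a subspace *)

Section LinearAlgebraModuloASubspace.
Variables (K : fieldType) (V : lmodType K).
Implicit Types (U W : V -> Prop) (s t : seq V) (c : nat -> K).

Definition subspace U := U 0 /\ forall a x y, U x -> U y -> U (a *: x + y).

Definition comb c s : V := \sum_(i < size s) c i *: s`_i.

Definition indep U s := forall c, U (comb c s) -> forall i, (i < size s)%N -> c i = 0.

Definition inspan U s (x : V) := exists c, U (x - comb c s).

Lemma subspace0 : subspace (fun x => x = 0).
Proof. by split=> // a x y -> ->; rewrite scaler0 addr0. Qed.

Section Subspace.
Variables (U : V -> Prop) (hU : subspace U).

Lemma sub0 : U 0. Proof. by case: hU. Qed.

Lemma subD x y : U x -> U y -> U (x + y).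
Proof. by move=> Ux Uy; rewrite -[x]scale1r; case: hU => _; apply. Qed.

Lemma subZ a x : U x -> U (a *: x).
Proof. by move=> Ux; rewrite -[_ *: _]addr0; case: hU => U0; apply. Qed.

Lemma subN x : U x -> U (- x).
Proof. by move=> Ux; rewrite -scaleN1r; apply: subZ. Qed.

Lemma sub_sum (I : Type) (r : seq I) (P : pred I) (F : I -> V) :
  (forall i, P i -> U (F i)) -> U (\sum_(i <- r | P i) F i).
Proof. by move=> UF; apply: big_ind => //; [exact: sub0 | exact: subD]. Qed.

(** More vectors than coordinates leave a nontrivial relation: the matrix of
    coordinates has a nonzero left kernel. *)
Lemma steinitz (I J : finType) (v : I -> V) (w : J -> V) :
    (forall c : I -> K, U (\sum_i c i *: v i) -> forall i, c i = 0) ->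
    (forall i, exists c : J -> K, U (v i - \sum_j c j *: w j)) ->
  (#|I| <= #|J|)%N.
Proof.
move=> vI /choice [M hM]; rewrite leqNgt; apply/negP => ltJI.
pose A := \matrix_(i < #|I|, j < #|J|) M (enum_val i) (enum_val j).
have : kermx A != 0.
  by rewrite -mxrank_eq0 mxrank_ker -lt0n subn_gt0 (leq_ltn_trans (rank_leq_col A)).
case/matrix0Pn => a [b ab0].
pose c i := kermx A a (enum_rank i).
have cA j : \sum_i c i * M i j = 0.
  have /matrixP/(_ a (enum_rank j)) := mulmx_ker A.
  rewrite mxE [RHS]mxE => kA; rewrite -[RHS]kA.
  rewrite (reindex_onto enum_val enum_rank) /=; last by move=> i _; rewrite enum_rankK.
  by apply: eq_big => [i|i _]; rewrite /c ?enum_valK ?eqxx // [A _ _]mxE enum_rankK.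
have := vI c; have -> : \sum_i c i *: v i =
    \sum_i c i *: (v i - \sum_j M i j *: w j).
  under [RHS]eq_bigr do rewrite scalerBr.
  rewrite big_split /= sumrN.
  under [X in _ - X]eq_bigr do rewrite scaler_sumr.
  rewrite exchange_big /= [X in _ - X]big1 ?subr0 // => j _.
  under eq_bigr do rewrite scalerA.
  by rewrite -scaler_suml cA scale0r.
move=> /(_ _ (enum_val b)) c0.
move: ab0; have := c0; rewrite /c enum_valK => -> //; first by rewrite eqxx.
by apply: sub_sum => i _; apply: subZ.
Qed.

Lemma comb_cat c s t :
  comb c (s ++ t) = comb c s + comb (fun i => c (size s + i)%N) t.
Proof.
rewrite /comb size_cat big_split_ord /=; congr (_ + _); apply: eq_bigr => i _.
  by rewrite nth_cat ltn_ord.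
by rewrite nth_cat ltnNge leq_addr /= addKn.
Qed.

Lemma comb_cons c x s : comb c (x :: s) = c 0%N *: x + comb (fun i => c i.+1) s.
Proof. by rewrite /comb /= big_ord_recl. Qed.

Lemma eq_comb c c' s :
  (forall i, (i < size s)%N -> c i = c' i) -> comb c s = comb c' s.
Proof. by move=> cc'; apply: eq_bigr => i _; rewrite cc'. Qed.

Lemma steinitz_seq s t :
  indep U s -> (forall x, x \in s -> inspan U t x) -> (size s <= size t)%N.
Proof.
move=> si st; rewrite -(card_ord (size s)) -(card_ord (size t)).
apply: (@steinitz 'I_(size s) 'I_(size t) (fun i => s`_i) (fun j => t`_j)) => [c Uc i|i].
  pose c' k := if insub k is Some i then c i else 0.
  have cE (j : 'I_(size s)) : c' j = c j by rewrite /c' valK.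
  rewrite -cE; apply: (si c') => //; rewrite /comb.
  by under eq_bigr do rewrite cE.
have /st [c Uc] : s`_i \in s by apply: mem_nth.
by exists (fun j : 'I_(size t) => c j).
Qed.

Lemma indep_cons x s : ~ inspan U s x -> indep U s -> indep U (x :: s).
Proof.
move=> xs si c; rewrite comb_cons => Uc.
have c0 : c 0%N = 0.
  apply/eqP; apply: contra_notT xs => c0.
  exists (fun i => - (c 0%N)^-1 * c i.+1).
  have := subZ (c 0%N)^-1 Uc; rewrite scalerDr scalerA mulVf // scale1r.
  congr (U (_ + _)); rewrite /comb scaler_sumr -sumrN; apply: eq_bigr => i _.
  by rewrite scalerA mulNr scaleNr opprK.
by move=> [|i] // /(si (fun i => c i.+1)) -> //; rewrite c0 scale0r add0r in Uc.
Qed.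

(** A vector of [P] outside the span would enlarge a family of maximal size. *)
Lemma extend_basis (P : V -> Prop) N s :
    (forall t, indep U t -> (forall x, x \in t -> P x) -> (size t <= N)%N) ->
    indep U s -> (forall x, x \in s -> P x) ->
  exists t, [/\ indep U (t ++ s), forall x, x \in t ++ s -> P x &
                forall x, P x -> inspan U (t ++ s) x].
Proof.
move=> bnd si sP.
pose Q k := `[< exists t, [/\ size t = k, indep U (t ++ s) &
   forall x, x \in t ++ s -> P x] >].
have exQ : exists k, Q k by exists 0%N; apply/asboolP; exists [::].
have QN k : Q k -> (k <= N)%N.
  move=> /asboolP [t [<- ti tP]]; apply: leq_trans (bnd _ ti tP).
  by rewrite size_cat leq_addr.
case: (ex_maxnP exQ QN) => k /asboolP [t [tk ti tP]] kmax.
exists t; split=> // x Px; apply: contrapT => xt.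
have : Q k.+1.
  apply/asboolP; exists (x :: t); split; first by rewrite /= tk.
    exact: indep_cons.
  by move=> y; rewrite /= inE => /orP [/eqP ->|/tP].
by move/kmax; rewrite ltnn.
Qed.

End Subspace.

(** The dimension of the image of [W] in the quotient by [U], which need not be
    contained in [W]. *)
Definition has_codim W U (r : nat) := exists s, [/\ size s = r, indep U s,
  forall x, x \in s -> W x & forall x, W x -> inspan U s x].

Lemma has_codim_bound W U r : subspace U -> has_codim W U r ->
  forall t, indep U t -> (forall x, x \in t -> W x) -> (size t <= r)%N.
Proof.
move=> hU [s [<- _ _ sW]] t ti tW; apply: (steinitz_seq hU ti) => x xt.
exact/sW/tW.
Qed.

Lemma comb_fam (I : finType) (v : I -> V) (c : nat -> K) :
  comb c [seq v i | i <- enum I] = \sum_i c (enum_rank i) *: v i.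
Proof.
rewrite /comb size_map -cardE [RHS](reindex_onto enum_val enum_rank) /=; last first.
  by move=> j _; rewrite enum_rankK.
apply: eq_big => [j|j _]; first by rewrite enum_valK eqxx.
rewrite enum_valK (nth_map (enum_val j)) -?cardE //.
by congr (_ *: v _); apply/esym/enum_val_nth.
Qed.

Lemma indep_fam (U : V -> Prop) (I : finType) (v : I -> V) :
    (forall c : I -> K, U (\sum_i c i *: v i) -> forall i, c i = 0) ->
  indep U [seq v i | i <- enum I].
Proof.
move=> vI c; rewrite comb_fam => Uc i; rewrite size_map -cardE => ilt.
by have := vI _ Uc (enum_val (Ordinal ilt)); rewrite enum_valK.
Qed.

Lemma inspan_fam (U : V -> Prop) (I : finType) (v : I -> V) (c : I -> K) x :
  U (x - \sum_i c i *: v i) -> inspan U [seq v i | i <- enum I] x.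
Proof.
move=> Uc; exists (fun k => if (insub k : option 'I_#|I|) is Some j
  then c (enum_val j) else 0).
rewrite comb_fam; move: Uc; congr (U (_ - _)); apply: eq_bigr => i _.
by rewrite valK enum_rankK.
Qed.

End LinearAlgebraModuloASubspace.

(** * Ideals *)

Section Ideals.
Variable A : comNzRingType.
Implicit Types (I J : A -> Prop) (l : seq A).

Definition ideal I :=
  [/\ I 0, forall x y, I x -> I y -> I (x + y) & forall a x, I x -> I (a * x)].

Definition isum I (a x : A) := exists z, I (x - z * a).

Fixpoint gen l : A -> Prop :=
  if l is a :: l' then isum (gen l') a else fun x => x = 0.

Definition nzd I (a : A) := forall z, I (a * z) -> I z.

Section Ideal.
Variables (I : A -> Prop) (hI : ideal I).

Lemma ideal0 : I 0. Proof. by case: hI. Qed.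

Lemma idealD x y : I x -> I y -> I (x + y).
Proof. by case: hI => _ + _; apply. Qed.

Lemma idealM a x : I x -> I (a * x).
Proof. by case: hI => _ _; apply. Qed.

Lemma idealMr a x : I x -> I (x * a).
Proof. by rewrite mulrC; apply: idealM. Qed.

Lemma idealN x : I x -> I (- x).
Proof. by rewrite -mulN1r; apply: idealM. Qed.

Lemma idealB x y : I x -> I y -> I (x - y).
Proof. by move=> Ix Iy; apply: idealD => //; apply: idealN. Qed.

Lemma ideal_sum (T : Type) (r : seq T) (P : pred T) (F : T -> A) :
  (forall i, P i -> I (F i)) -> I (\sum_(i <- r | P i) F i).
Proof. by move=> IF; apply: big_ind => //; [exact: ideal0 | exact: idealD]. Qed.

Lemma ideal_congr x y : I (x - y) -> I y -> I x.
Proof. by move=> Ixy Iy; rewrite -(subrK y x); apply: idealD. Qed.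

Lemma ideal_isum a : ideal (isum I a).
Proof.
split=> [|x y [z Iz] [w Iw]|b x [z Iz]].
- by exists 0; rewrite mul0r subr0; apply: ideal0.
- by exists (z + w); rewrite mulrDl opprD addrACA; apply: idealD.
- by exists (b * z); rewrite -mulrA -mulrBr; apply: idealM.
Qed.

Lemma sub_isum a x : I x -> isum I a x.
Proof. by move=> Ix; exists 0; rewrite mul0r subr0. Qed.

Lemma mem_isum a z : isum I a (z * a).
Proof. by exists z; rewrite subrr; apply: ideal0. Qed.

Lemma gen_sub l : (forall x, x \in l -> I x) -> forall x, gen l x -> I x.
Proof.
elim: l => [|a l IH] lI x /=; first by move=> ->; apply: ideal0.
have /IH{}IH y : y \in l -> I y by move=> yl; apply: lI; rewrite inE yl orbT.
case=> z /IH Iz; apply: ideal_congr Iz _; apply: idealM.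
by apply: lI; rewrite inE eqxx.
Qed.

End Ideal.

Lemma ideal_gen l : ideal (gen l).
Proof.
elim: l => [|a l IH] /=; last exact: ideal_isum.
by split=> // [x y -> ->|a x ->]; rewrite ?addr0 ?mulr0.
Qed.

Lemma mem_gen l x : x \in l -> gen l x.
Proof.
elim: l => // a l IH; rewrite inE /= => /orP [/eqP ->|/IH]; last exact: sub_isum.
by rewrite -{2}[a]mul1r; apply/mem_isum/ideal_gen.
Qed.

Lemma gen_subset l l' : {subset l <= l'} -> forall x, gen l x -> gen l' x.
Proof.
move=> ll'; apply: gen_sub; first exact: ideal_gen.
by move=> x /ll'; apply: mem_gen.
Qed.

End Ideals.

Section PolynomialIdeals.
Variables (K : fieldType) (n : nat).
Local Notation A := {mpoly K[n]}.

Lemma ideal_subspace (I : A -> Prop) : ideal I -> subspace I.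
Proof.
move=> hI; split=> [|a x y Ix Iy]; first exact: ideal0.
by apply: idealD => //; rewrite -mul_mpolyC; apply: idealM.
Qed.

Lemma gen_eval0 (l : seq A) z x :
  (forall p, p \in l -> p.@[z] = 0) -> gen l x -> x.@[z] = 0.
Proof.
move=> lz; apply: gen_sub lz x; split.
- exact: meval0.
- by move=> x y x0 y0; rewrite mevalD x0 y0 addr0.
- by move=> a x x0; rewrite mevalM x0 mulr0.
Qed.

(** The instances of [s] are evaluation at a point, setting some variables to
    zero, and restriction to a line followed by evaluation at its base point. *)
Lemma subst_mod (J : A -> Prop) (s : {rmorphism A -> A}) : ideal J ->
    (forall c, s c%:MP = c%:MP) -> (forall i, J ('X_i - s 'X_i)) ->
  forall p, J (p - s p).
Proof.
move=> hJ sC Js; apply: mpolyind => [|a m p _ _ Jp].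
  by rewrite rmorph0 subrr; apply: ideal0.
rewrite rmorphD opprD addrACA; apply: idealD => //.
rewrite -mul_mpolyC rmorphM sC -mulrBr; apply: idealM => //.
have JM x y x' y' : J (x - x') -> J (y - y') -> J (x * y - x' * y').
  move=> Jx Jy; rewrite -(subrK (x' * y) (x * y)) -addrA -mulrBl -mulrBr.
  by apply: idealD => //; [apply: idealMr | apply: idealM].
rewrite mpolyXE_id rmorph_prod /=.
elim/big_ind2: _ => [|x x' y y' Jx Jy|i _]; first by rewrite subrr; apply: ideal0.
  exact: JM.
elim: (m i) => [|k IH]; first by rewrite !expr0 rmorph1 subrr; apply: ideal0.
by rewrite !exprS rmorphM; apply: JM.
Qed.

Lemma eval_mod (J : A -> Prop) (c : 'I_n -> K) : ideal J ->
  (forall i, J ('X_i - (c i)%:MP)) -> forall p, J (p - p.@[c]%:MP).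
Proof.
move=> hJ Jc; apply: (@subst_mod J (@mpolyC n K \o meval c)) => // [a|i] /=.
  by rewrite mevalC.
by rewrite mevalXU.
Qed.

End PolynomialIdeals.

(** * The Nullstellensatz over an uncountable field *)

Section Nullstellensatz.
Variables (K : closedFieldType) (n : nat).
Local Notation A := {mpoly K[n]}.

(** The consequence of uncountability that the Nullstellensatz needs. *)
Definition big_fibres (T : eqType) := forall phi : T -> nat,
  exists m, forall N, exists s : seq T,
    [/\ uniq s, size s = N & forall x, x \in s -> phi x = m].

Hypothesis K_big : big_fibres K.

(** Otherwise every [X_i - c] has a multiple [u_c (X_i - c)] that is congruent
    to a power of [h].  Since [K] is uncountable, many values of [c] share the
    exponent of [h] and the degree of [u_c], hence some of these [u_c] are
    linearly dependent.  Multiplying a dependency by the [X_i - c] gives a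
    nonzero polynomial in [X_i] alone that lies in [I] after multiplication by
    a power of [h]; its linear factors are then traded for powers of [h]. *)
Lemma nullstellensatz_step (I : A -> Prop) (h : A) (i : 'I_n) : ideal I ->
    (forall k, ~ I (h ^+ k)) ->
  exists c : K, forall k, ~ isum I ('X_i - c%:MP) (h ^+ k).
Proof.
move=> hI Ih; apply: contrapT => /forallNP noc.
have {noc} : forall c, exists ku : nat * A, I (h ^+ ku.1 - ku.2 * ('X_i - c%:MP)).
  by move=> c; have /existsNP [k /contrapT [u ?]] := noc c; exists (k, u).
move=> /choice [ku Iku].
have clear (r : seq K) k P : I (h ^+ k * (P * \prod_(c <- r) ('X_i - c%:MP))) ->
    exists k', I (h ^+ k' * P).
  elim: r k P => [|c r IH] k P; first by rewrite big_nil mulr1; exists k.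
  rewrite big_cons [P * _]mulrA => /IH [{}k Ik].
  exists (k + (ku c).1)%N; rewrite exprD -mulrA.
  have -> : h ^+ k * (h ^+ (ku c).1 * P) =
    h ^+ k * P * (h ^+ (ku c).1 - (ku c).2 * ('X_i - c%:MP)) +
    (ku c).2 * (h ^+ k * (P * ('X_i - c%:MP))).
    by ring.
  by apply: idealD => //; apply: idealM.
pose phi c := pickle ((ku c).1, msize (ku c).2).
have [m fib] := K_big phi.
have [c0 phi0] : exists c, phi c = m.
  have [[|c0 s0] [] // _ _ s0m] := fib 1%N.
  by exists c0; apply/s0m/mem_head.
set k := (ku c0).1 in phi0; set d := msize (ku c0).2 in phi0.
have fibE c : phi c = m -> (ku c).1 = k /\ msize (ku c).2 = d.
  by rewrite -phi0 => /(pcan_inj (@pickleK _)) [-> ->].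
have [s [us ss sm]] := fib #|{: 'X_{1..n < d}}|.+1.
have {}sm j : (j < size s)%N -> (ku s`_j).1 = k /\ msize (ku s`_j).2 = d.
  by move=> js; apply/fibE/sm/mem_nth.
have [lam lam0 [j0 lamj0]] : exists2 lam : 'I_(size s) -> K,
    \sum_j lam j *: (ku s`_j).2 = 0 & exists j, lam j <> 0.
  apply: contrapT => nolam.
  have : (#|'I_(size s)| <= #|{: 'X_{1..n < d}}|)%N.
    apply: (steinitz (subspace0 A) (v := fun j : 'I_(size s) => (ku s`_j).2)
      (w := fun m : 'X_{1..n < d} => 'X_[m])) => [c c0'|j].
      move=> j; apply: contrapT => cj; apply: nolam; exists c => //.
      by exists j.
    have [_ sd] := sm j (ltn_ord j).
    exists (fun m : 'X_{1..n < d} => (ku s`_j).2@_m).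
    by apply/eqP; rewrite subr_eq0 {1}[(ku s`_j).2](@mpolywE _ _ d) ?sd.
  by rewrite card_ord ss ltnn.
(* the nonzero polynomial in [X_i]: at the node [s`_j] its value is a nonzero
   multiple of [lam j] *)
pose p : {poly K} := \sum_(j < size s) lam j *:
  \prod_(l < size s | l != j) ('X - (s`_l)%:P).
have p_neq0 : p != 0.
  apply/eqP => /(congr1 (horner^~ s`_j0)).
  rewrite horner0 /p horner_sum (bigD1 j0) //= [X in _ + X]big1 ?addr0 => [|j jj0].
    rewrite hornerZ horner_prod => /eqP; rewrite mulf_eq0 => /orP [/eqP //|].
    move=> /prodf_eq0 [l lj0]; rewrite !hornerE subr_eq0 nth_uniq //.
    by rewrite eq_sym => /eqP/val_inj/eqP; rewrite (negPf lj0).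
  rewrite hornerZ horner_prod (bigD1 j0) 1?eq_sym //=.
  by rewrite hornerXsubC subrr mul0r mulr0.
pose ev (q : {poly K}) : A := (map_poly (@mpolyC n K) q).['X_i].
have evX c : ev ('X - c%:P) = 'X_i - c%:MP.
  by rewrite /ev rmorphB /= map_polyX map_polyC /= !hornerE.
have evZ c q : ev (c *: q) = c%:MP * ev q.
  by rewrite /ev map_polyZ /= hornerZ.
have evM (T : finType) (P : pred T) (F : T -> {poly K}) :
    ev (\prod_(t | P t) F t) = \prod_(t | P t) ev (F t).
  by rewrite /ev rmorph_prod horner_prod.
have hp : I (h ^+ k * ev p).
  have -> : ev p = \sum_(j < size s) (lam j)%:MP *
      \prod_(l < size s | l != j) ('X_i - (s`_l)%:MP).
    rewrite /ev /p rmorph_sum /= horner_sum; apply: eq_bigr => j _.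
    rewrite -/(ev _) evZ evM; congr (_ * _).
    by apply: eq_bigr => l _; rewrite evX.
  have -> : h ^+ k * (\sum_(j < size s) (lam j)%:MP *
        \prod_(l < size s | l != j) ('X_i - (s`_l)%:MP)) =
      \sum_(j < size s) (lam j)%:MP * \prod_(l < size s | l != j)
         ('X_i - (s`_l)%:MP) * (h ^+ k - (ku s`_j).2 * ('X_i - (s`_j)%:MP)).
    have S0 : \sum_(j < size s) (lam j)%:MP * (ku s`_j).2 *
        \prod_(l < size s) ('X_i - (s`_l)%:MP) = 0.
      rewrite -mulr_suml; under eq_bigr do rewrite mul_mpolyC.
      by rewrite lam0 mul0r.
    under [RHS]eq_bigr do rewrite mulrBr.
    rewrite sumrB mulr_sumr -[LHS]subr0; congr (_ - _).
      by apply: eq_bigr => j _; rewrite mulrC.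
    rewrite -[LHS]S0; apply: eq_bigr => j _.
    by rewrite (bigD1 j) //=; ring.
  apply: ideal_sum => // j _; apply: idealM => //.
  have [<- _] := sm j (ltn_ord j).
  exact: Iku.
have [r pE] := closed_field_poly_normal p.
have [k' Ik'] : exists k', I (h ^+ k' * (lead_coef p)%:MP).
  apply: (clear r k); move: hp; rewrite {1}pE evZ.
  suff -> : ev (\prod_(z <- r) ('X - z%:P)) = \prod_(c <- r) ('X_i - c%:MP) by [].
  by rewrite /ev rmorph_prod horner_prod; apply: eq_bigr => c _; rewrite -/(ev _).
apply: (Ih k'); move: (idealMr hI (lead_coef p)^-1%:MP Ik').
by rewrite -mulrA -mpolyCM mulfV ?lead_coef_eq0 // mpolyC1 mulr1.
Qed.

(** Zeros are found one coordinate at a time.  Carrying along all powers of [h]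
    gives the strong form of the theorem without an auxiliary variable. *)
Theorem nullstellensatz (I : A -> Prop) (h : A) : ideal I ->
    (forall z, (forall p, I p -> p.@[z] = 0) -> h.@[z] = 0) ->
  exists k, I (h ^+ k).
Proof.
move=> hI hz; apply: contrapT => /forallNP Ih.
have [J [hJ IJ Jh [c Jc]]] : exists J, [/\ ideal J, forall x, I x -> J x,
    forall k, ~ J (h ^+ k) & exists c : 'I_n -> K,
      forall i, i \in enum 'I_n -> J ('X_i - (c i)%:MP)].
  elim: (enum 'I_n) => [|i l [J [hJ IJ Jh [c Jc]]]].
    by exists I; split=> //; exists (fun=> 0).
  have [ci Jci] := nullstellensatz_step i hJ Jh.
  exists (isum J ('X_i - ci%:MP)); split=> //; first exact: ideal_isum.
    by move=> x /IJ; apply: sub_isum.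
  exists (fun j => if j == i then ci else c j) => j.
  rewrite inE; case: eqVneq => [-> _|_ /=].
    by rewrite -[X in isum _ _ X]mul1r; apply: mem_isum.
  by move=> /Jc; apply: sub_isum.
have Jev := eval_mod hJ (fun i => Jc i (mem_enum _ i)).
have Jval p : J p -> p.@[c] = 0.
  move=> Jp; apply/eqP; apply: contra_notT (Jh 0%N) => pc0.
  have : J p.@[c]%:MP by rewrite -[_%:MP](subKr p); apply: idealB.
  move=> /(idealM hJ (p.@[c]^-1)%:MP).
  by rewrite -mpolyCM mulVf // mpolyC1 expr0.
apply: (Jh 1%N); rewrite expr1.
rewrite -[h]subr0 -(mpolyC0 n) -[in _%:MP](hz c) // => p /IJ; exact: Jval.
Qed.

End Nullstellensatz.

(** * Regular sequences of homogeneous elements *)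

Section GradedIdeals.
Variables (K : fieldType) (n : nat).
Local Notation A := {mpoly K[n]}.
Local Notation pih := (pihomog mdeg).
Implicit Types (I : A -> Prop) (l : seq A).

Definition graded I := ideal I /\ forall p d, I p -> I (pih d p).

Definition hpos l := forall p, p \in l -> exists2 d, (0 < d)%N & p \is d.-homog.

(** A regular sequence, listed from its last element to its first. *)
Fixpoint reg l : Prop :=
  if l is a :: l' then nzd (gen l') a /\ reg l' else True.

Lemma pihomogM_homog (z a : A) d e : a \is e.-homog ->
  pih (d + e) (z * a) = pih d z * a.
Proof.
move=> ha; elim/mpolyind: z => [|c m p _ _ IH].
  by rewrite pihomog0 !mul0r pihomog0.
rewrite mulrDl !linearD /= IH mulrDl -scalerAl !linearZ /= -scalerAl.
congr (_ *: _ + _).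
have hm : 'X_[m] * a \is (mdeg m + e).-homog.
  by apply: dhomogM => //; rewrite dhomogX.
rewrite pihomogX; case: eqVneq => [<-|md]; first by rewrite pihomog_dE.
by rewrite mul0r (pihomog_ne0 _ hm) // eqn_add2r.
Qed.

Lemma pihomogM_homog0 (z a : A) d e : a \is e.-homog -> (d < e)%N ->
  pih d (z * a) = 0.
Proof.
move=> ha de; elim/mpolyind: z => [|c m p _ _ IH].
  by rewrite mul0r pihomog0.
rewrite mulrDl linearD /= IH addr0 -scalerAl linearZ /=.
have hm : 'X_[m] * a \is (mdeg m + e).-homog.
  by apply: dhomogM => //; rewrite dhomogX.
by rewrite (pihomog_ne0 _ hm) ?scaler0 // gtn_eqF // ltn_addl.
Qed.

Lemma sum_pihomog (p : A) : p = \sum_(d < msize p) pih d p.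
Proof. exact: pihomog_partitionE. Qed.

Lemma graded_isum I a e : graded I -> a \is e.-homog -> graded (isum I a).
Proof.
move=> [hI Ih] ha; split; first exact: ideal_isum.
move=> p d [z /(Ih _ d)]; rewrite linearB /=.
have [ed|de] := leqP e d.
  by rewrite -{2}(subnK ed) pihomogM_homog // => Iz; exists (pih (d - e) z).
by rewrite (pihomogM_homog0 _ ha) // subr0; apply: sub_isum.
Qed.

Lemma graded_gen l : hpos l -> graded (gen l).
Proof.
elim: l => [|a l IH] hl /=.
  by split; [exact: (@ideal_gen _ [::]) | move=> p d ->; rewrite pihomog0].
have [d _ ha] := hl a (mem_head _ _).
by apply: (graded_isum _ ha); apply: IH => p pl; apply: hl; rewrite inE pl orbT.
Qed.

Lemma isum_homog I G p d e : graded I -> G \is e.-homog ->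
    p \is (d + e).-homog -> isum I G p ->
  exists2 w, w \is d.-homog & I (p - w * G).
Proof.
move=> [hI Ih] hG hp [z /(Ih _ (d + e)%N)].
rewrite linearB /= pihomogM_homog // pihomog_dE // => Iz.
by exists (pih d z) => //; apply: pihomogP.
Qed.

Lemma nzd_homog I a e : graded I -> a \is e.-homog ->
  (forall d z, z \is d.-homog -> I (a * z) -> I z) -> nzd I a.
Proof.
move=> [hI Ih] ha Ia z; rewrite mulrC => Iz; rewrite [z]sum_pihomog.
apply: ideal_sum => // d _; apply: (Ia d); first exact: pihomogP.
by rewrite mulrC -(@pihomogM_homog _ _ _ e) //; apply: Ih.
Qed.

Lemma nzdX I a k : nzd I a -> nzd I (a ^+ k).
Proof.
move=> Ia; elim: k => [|k IH] z; first by rewrite mul1r.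
by rewrite exprS -mulrA => /Ia/IH.
Qed.

Lemma nzd_ext I J a : (forall x, I x <-> J x) -> nzd I a -> nzd J a.
Proof. by move=> IJ Ia z /IJ/Ia/IJ. Qed.

(** Neighbours in a regular sequence of homogeneous elements of positive degree
    may be exchanged; positivity lets an induction on degrees replace Nakayama's
    lemma. *)
Lemma nzd_swap I a b d e : graded I -> (0 < d)%N ->
    a \is d.-homog -> b \is e.-homog ->
    nzd I a -> nzd (isum I a) b -> nzd I b /\ nzd (isum I b) a.
Proof.
move=> gI d0 ha hb Ia Iab; have [hI Ih] := gI.
have Ib : nzd I b.
  apply: (nzd_homog gI hb) => D; elim/ltn_ind: D => D IH z hz Ibz.
  have Iaz : isum I a z by apply: Iab; apply: sub_isum.
  have [dD|Dd] := leqP d D.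
    have := hz; rewrite -(subnK dD) => hz'.
    have [w hw Izw] := isum_homog gI ha hz' Iaz.
    apply: (ideal_congr hI Izw); apply: idealMr => //.
    apply: (IH _ _ _ hw); first by rewrite ltn_subrL d0 (leq_trans d0 dD).
    apply: Ia; have -> : a * (b * w) = b * z - b * (z - w * a) by ring.
    by apply: idealB => //; apply: idealM.
  case: Iaz => w /(Ih _ D); rewrite linearB /= (pihomogM_homog0 _ ha) // subr0.
  by rewrite pihomog_dE.
split=> // z [w Iw].
have /Iab [v Iv] : isum I a (b * w).
  exists z; have -> : b * w - z * a = - (a * z - w * b) by ring.
  exact: idealN.
exists v; apply: Ia.
have -> : a * (z - v * b) = (a * z - w * b) + b * (w - v * a) by ring.
by apply: idealD => //; apply: idealM.
Qed.

Lemma gen_perm l l' : perm_eq l l' -> forall x, gen l x <-> gen l' x.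
Proof.
move=> /perm_mem ll' x.
by split; apply: gen_subset => y; rewrite ll'.
Qed.

Lemma reg_swap a b l : hpos (a :: b :: l) -> reg (a :: b :: l) ->
  reg (b :: a :: l).
Proof.
move=> hl [/= ra [rb rl]].
have hl' : hpos l by move=> p pl; apply: hl; rewrite !inE pl !orbT.
have [d d0 ha] : exists2 d, (0 < d)%N & a \is d.-homog.
  by apply: hl; rewrite inE eqxx.
have [e e0 hb] : exists2 d, (0 < d)%N & b \is d.-homog.
  by apply: hl; rewrite !inE eqxx orbT.
by have [] := nzd_swap (graded_gen hl') e0 hb ha rb ra.
Qed.

Lemma hpos_sub l l' : {subset l' <= l} -> hpos l -> hpos l'.
Proof. by move=> ll' hl p /ll' /hl. Qed.

Lemma reg_move a l1 l2 : hpos (a :: l1 ++ l2) ->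
  reg (a :: l1 ++ l2) <-> reg (l1 ++ a :: l2).
Proof.
elim: l1 => // c l1 IH hl.
have hal : hpos (a :: l1 ++ l2).
  by apply: hpos_sub hl => x; rewrite !inE => /orP [->|->] //; rewrite !orbT.
have hcal : hpos (c :: a :: l1 ++ l2).
  by apply: hpos_sub hl => x; rewrite !inE orbCA.
have pe : perm_eq (a :: l1 ++ l2) (l1 ++ a :: l2).
  by rewrite perm_sym; apply/permPl/(perm_catCA l1 [:: a]).
split=> [/(reg_swap hl) [rc ra]|[rc ra]].
  split; last by apply/IH.
  exact: nzd_ext (gen_perm pe) rc.
apply: reg_swap => //; split; last by apply/IH.
by apply: nzd_ext rc => x; rewrite (gen_perm pe).
Qed.

(** Modulo some of the variables, an element is determined by setting them to
    zero, and the remaining variables stay nonzero. *)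
Lemma reg_variables : reg [seq 'X_i : A | i <- enum 'I_n].
Proof.
have := enum_uniq 'I_n; elim: (enum 'I_n) => // i l IH /= /andP [il /IH rl].
split=> //.
pose h := [tuple if j \in l then 0 else 'X_j : A | j < n].
have genE p : gen [seq 'X_j | j <- l] p <-> p \mPo h = 0.
  split; last first.
    move=> p0; rewrite -[p]subr0 -p0.
    apply: (@subst_mod K n _ (comp_mpoly h)
      (ideal_gen [seq 'X_j | j <- l])) => [c|j] /=.
      by rewrite comp_mpolyC.
    rewrite comp_mpolyXU -tnth_nth tnth_mktuple; case: ifP => jl.
      by rewrite subr0; apply/mem_gen/map_f.
    by rewrite subrr; apply: (ideal0 (ideal_gen _)).
  apply: (@gen_sub _ (fun p => p \mPo h = 0)) p.
    split; first exact: comp_mpoly0.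
      by move=> x y x0 y0; rewrite comp_mpolyD x0 y0 addr0.
    by move=> a x x0; rewrite rmorphM /= x0 mulr0.
  move=> x /mapP [j jl ->].
  by rewrite comp_mpolyXU -tnth_nth tnth_mktuple jl.
move=> z /genE; rewrite rmorphM /= comp_mpolyXU -tnth_nth tnth_mktuple (negPf il).
by move/eqP; rewrite mulf_eq0 -msize_poly_eq0 msizeX => /= /eqP/genE.
Qed.

Lemma monomial_divides_power (k : 'I_n -> nat) (m : 'X_{1..n}) :
    (\sum_i k i < mdeg m)%N ->
  exists i, 'X_[m] = 'X_i ^+ k i * 'X_[m - U_(i) *+ k i] :> A.
Proof.
move=> km; have [i ki] : exists i, (k i <= m i)%N.
  apply/existsP; apply: contraLR km; rewrite negb_exists => /forallP lt.
  rewrite -leqNgt mdegE.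
  by apply: leq_sum => i _; have := lt i; rewrite -ltnNge => /ltnW.
exists i; rewrite mpolyXn -mpolyXD addmC submK //.
apply/mnm_lepP => j; rewrite mulmnE mnm1E.
by case: eqVneq => [<-|_]; rewrite ?mul1n ?mul0n.
Qed.

Lemma homog_msize_le (p : A) d : p \is d.-homog -> (msize p <= d.+1)%N.
Proof.
move=> /dhomogP hp; have [->|p0] := eqVneq p 0; first by rewrite msize0.
by rewrite -mlead_deg // (hp _ (mlead_supp p0)).
Qed.


End GradedIdeals.

(** * Homogeneous systems of parameters *)

Section RegularSystemsOfParameters.
Variables (K : closedFieldType) (n : nat).
Hypothesis K_big : big_fibres K.
Local Notation A := {mpoly K[n]}.
Implicit Types (I : A -> Prop) (l : seq A).

(** When [l] consists of [n] forms, this says that they are a homogeneous system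
    of parameters. *)
Definition sop l :=
  forall z : 'I_n -> K, (forall p, p \in l -> p.@[z] = 0) -> forall i, z i = 0.

Definition cofinite I N :=
  forall p d, (N <= d)%N -> p \is d.-homog -> I p.

(** Each variable has a power in the ideal, and a monomial of large degree is
    divisible by one of these powers. *)
Lemma sop_cofinite l : sop l -> exists N, cofinite (gen l) N.
Proof.
move=> sl.
have /choice [k hk] : forall i : 'I_n, exists k, gen l ('X_i ^+ k).
  move=> i; apply: (nullstellensatz K_big); first exact: ideal_gen.
  move=> z zl; rewrite mevalXU; apply: sl => p pl.
  by apply/zl/mem_gen.
exists (\sum_i k i).+1 => p d Nd /dhomogP hp.
rewrite [p]mpolyE big_seq; apply: ideal_sum => [|m /hp md]; first exact: ideal_gen.
rewrite -mul_mpolyC; apply: idealM; first exact: ideal_gen.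
have [|i ->] := @monomial_divides_power K n k m; first by rewrite md.
by apply: idealMr => //; exact: ideal_gen.
Qed.

(** In large degrees multiplication by [G] is onto modulo [I], hence so is
    multiplication by its powers. *)
Lemma divide_by_power I G e N k : graded I -> G \is e.-homog ->
    cofinite (isum I G) N -> forall m p, (N <= m)%N -> p \is (m + e * k).-homog ->
  exists2 w, w \is m.-homog & I (p - w * G ^+ k).
Proof.
move=> gI hG cG m; have [hI _] := gI; elim: k => [|k IH] p Nm hp.
  exists p; first by move: hp; rewrite muln0 addn0.
  by rewrite mulr1 subrr; apply: ideal0.
have hp' : p \is (m + e * k + e).-homog by rewrite -addnA -mulnSr.
have Gp : isum I G p by apply: (cG p _ _ hp); rewrite (leq_trans Nm) ?leq_addr.
have [w hw Iw] := isum_homog gI hG hp' Gp.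
have [v hv Iv] := IH w Nm hw.
exists v => //; rewrite exprSr.
have -> : p - v * (G ^+ k * G) = (p - w * G) + (w - v * G ^+ k) * G by ring.
by apply: idealD => //; apply: idealMr.
Qed.

(** Let [B = A / I].  If [y] is a nonzerodivisor, multiplication by powers of
    [y] shows that the dimensions of the graded pieces of [B] do not decrease;
    if [B / G B] has finite length, multiplication by powers of [G] is onto in
    large degrees, and a kernel would make the dimensions drop. *)
Lemma nzd_exchange I y G d e N : graded I -> y \is d.-homog -> G \is e.-homog ->
    (0 < d)%N -> (0 < e)%N ->
    nzd I y -> cofinite (isum I G) N -> nzd I G.
Proof.
move=> gI hy hG d0 e0 Iy cG; have [hI _] := gI.
have sI := ideal_subspace hI.
apply: (nzd_homog gI hG) => c z hz IGz; apply: contrapT => Iz.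
(* moving [z] into a degree in which multiplication by [G] is onto; the basis
   of this piece is chosen to contain the element [z1] killed by [G] *)
pose z1 := y ^+ N * z; pose m := (d * N + c)%N.
have hz1 : z1 \is m.-homog by apply: dhomogM => //; apply: dhomogMn.
have Iz1 : ~ I z1 by move=> /(nzdX Iy).
have IGz1 : I (G * z1).
  by rewrite /z1 mulrCA; apply: idealM.
have Nm : (N <= m)%N by rewrite (leq_trans (leq_pmull N d0)) // leq_addr.
have [| | |t [ti tP tsp]] := @extend_basis _ _ I sI (fun p => p \is m.-homog)
    #|{: 'X_{1..n < m.+1}}| [:: z1].
- move=> t ti tW; rewrite cardE -(size_map (fun j : 'X_{1..n < m.+1} => 'X_[j] : A)).
  apply: (steinitz_seq sI ti) => x xt.
  apply: (inspan_fam (c := fun j : 'X_{1..n < m.+1} => x@_j)).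
  rewrite -mpolywE ?subrr; first exact: ideal0.
  exact/homog_msize_le/tW.
- apply: indep_cons => //.
  by move=> [a]; rewrite /comb big_ord0 subr0.
- by move=> x; rewrite inE => /eqP ->.
pose B := t ++ [:: z1].
suff : (size B <= size t)%N by rewrite /B size_cat addn1 ltnn.
rewrite -[X in (X <= _)%N]card_ord -[X in (_ <= X)%N]card_ord.
apply: (steinitz sI (v := fun i : 'I_(size B) => y ^+ e * B`_i)
   (w := fun j : 'I_(size t) => t`_j * G ^+ d)) => [a Ia i|i].
  pose a' k := if insub k is Some i then a i else 0.
  have aE (j : 'I_(size B)) : a' j = a j by rewrite /a' valK.
  rewrite -aE; apply: (ti a') => //; rewrite /comb -/B.
  under eq_bigr do rewrite aE.
  apply: (nzdX Iy (k := e)); move: Ia; rewrite mulr_sumr.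
  by under eq_bigr do rewrite scalerAr.
have hB : y ^+ e * B`_i \is (m + e * d).-homog.
  rewrite addnC mulnC; apply: dhomogM; first exact: dhomogMn.
  by apply/tP/mem_nth.
have [w /tsp [a Ia] Iw] := divide_by_power gI hG cG Nm hB.
exists (fun j : 'I_(size t) => a j).
have -> : y ^+ e * B`_i - \sum_(j < size t) a j *: (t`_j * G ^+ d) =
    (y ^+ e * B`_i - w * G ^+ d) + (w - comb a B) * G ^+ d
    + a (size t) *: (z1 * G ^+ d).
  have -> : \sum_(j < size t) a j *: (t`_j * G ^+ d) = comb a t * G ^+ d.
    by rewrite /comb mulr_suml; apply: eq_bigr => j _; rewrite scalerAl.
  rewrite /B comb_cat; have -> : comb (fun j => a (size t + j)%N) [:: z1] =
     a (size t) *: z1 by rewrite /comb big_ord1 /= addn0.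
  by rewrite -mul_mpolyC -[in RHS]mul_mpolyC; ring.
apply: idealD => //; first by apply: idealD => //; apply: idealMr.
rewrite -mul_mpolyC; apply: idealM => //.
by rewrite -(prednK d0) exprS mulrA [z1 * G]mulrC; apply: idealMr.
Qed.

(** Modulo [L] an element of degree [d * N + d * j] is a multiple of [a ^ j] by an
    element of degree [d * N], so that their dimensions are bounded,
    whereas the number of products of degree [e] in the two powers is [e + 1]. *)
Lemma binary_form L a a' d d' : hpos L -> (0 < d)%N -> (0 < d')%N ->
    a \is d.-homog -> a' \is d'.-homog -> sop (a :: L) ->
  exists e, exists2 c : 'I_e.+1 -> K, exists i, c i <> 0 &
    gen L (\sum_i c i *: ((a ^+ d') ^+ i * (a' ^+ d) ^+ (e - i))).
Proof.
move=> hL d0 d'0 ha ha' /sop_cofinite [N cN].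
have gL := graded_gen hL; have [iL _] := gL; have sL := ideal_subspace iL.
pose C := #|{: 'X_{1..n < (d * N).+1}}|.
exists (N + C)%N; apply: contrapT => noc.
have : (#|'I_(N + C).+1| <= C)%N.
  apply: (steinitz sL (w := fun j : 'X_{1..n < (d * N).+1} =>
     'X_[j] * a ^+ ((N + C) * d' - N))
     (v := fun i : 'I_(N + C).+1 => (a ^+ d') ^+ i * (a' ^+ d) ^+ (N + C - i)))
     => [c Lc i|i].
    by apply: contrapT => ci; apply: noc; exists c => //; exists i.
  have hv : (a ^+ d') ^+ i * (a' ^+ d) ^+ (N + C - i) \is
      (d * N + d * ((N + C) * d' - N)).-homog.
    have := dhomogM (dhomogMn i (dhomogMn d' ha))
      (dhomogMn (N + C - i) (dhomogMn d ha')).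
    congr (_ \is _.-homog); rewrite -mulnDr subnKC; last first.
      by rewrite (leq_trans (leq_addr C N)) // leq_pmulr.
    rewrite [(d' * d)%N]mulnC -mulnDr subnKC; last by rewrite -ltnS.
    by rewrite -mulnA [(d' * _)%N]mulnC.
  have [w hw Iw] := divide_by_power gL ha cN (leq_pmull N d0) hv.
  exists (fun j : 'X_{1..n < (d * N).+1} => w@_j).
  have -> : \sum_(j : 'X_{1..n < (d * N).+1})
       w@_j *: ('X_[j] * a ^+ ((N + C) * d' - N)) = w * a ^+ ((N + C) * d' - N).
    rewrite [in RHS](@mpolywE _ _ (d * N).+1 w); last exact: homog_msize_le.
    by rewrite mulr_suml; apply: eq_bigr => j _; rewrite scalerAl.
  by [].
by rewrite card_ord ltnNge leq_addl.
Qed.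

Lemma nonroot (q : {poly K}) : q != 0 -> exists x, q.[x] != 0.
Proof.
move=> q0; have [m fib] := K_big (fun=> 0%N).
have [s [us ss _]] := fib (size q).
have [/allP sq|] := boolP (all (root q) s).
  have /allP := sq; move=> /(max_poly_roots q0)/(_ us).
  by rewrite ss ltnn.
by rewrite -has_predC => /hasP [x _ xq]; exists x.
Qed.

(** Any two systems of parameters can be linked: the pencil spanned by suitable
    powers of [a] and [a'] contains a member that completes both [L] and [L'],
    because on the lines where [L] vanishes the ratio of the two powers takes
    only finitely many values. *)
Lemma common_parameter L L' a a' d d' : hpos L -> hpos L' ->
    (0 < d)%N -> (0 < d')%N -> a \is d.-homog -> a' \is d'.-homog ->
    sop (a :: L) -> sop (a' :: L') ->
  exists2 y, (exists2 e, (0 < e)%N & y \is e.-homog) &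
    sop (y :: L) /\ sop (y :: L').
Proof.
move=> hL hL' d0 d'0 ha ha' sL sL'.
have [e [c [i0 ci0] Lc]] := binary_form hL d0 d'0 ha ha' sL.
have [e' [c' [i0' ci0'] Lc']] := binary_form hL' d'0 d0 ha' ha sL'.
(* the values to be avoided by [lam] are the roots of the two dehomogenized
   binary forms *)
pose q := \poly_(i < e.+1) c (inord (e - i)).
pose q' := \poly_(i < e'.+1) c' (inord i).
have q_neq0 : q != 0.
  apply/eqP => /(congr1 (fun p : {poly K} => p`_(e - i0))).
  rewrite coef0 coef_poly ltnS leq_subr subKn; last by rewrite -ltnS.
  rewrite inord_val.
  exact: ci0.
have q'_neq0 : q' != 0.
  apply/eqP => /(congr1 (fun p : {poly K} => p`_i0')).
  by rewrite coef0 coef_poly ltn_ord inord_val; apply: ci0'.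
have [lam] := nonroot (mulf_neq0 q_neq0 q'_neq0).
rewrite hornerM mulf_eq0 negb_or => /andP [qlam q'lam].
exists (a' ^+ d - lam *: a ^+ d').
  exists (d * d')%N; first by rewrite muln_gt0 d0.
  apply: rpredB; first by rewrite mulnC; apply: dhomogMn.
  by apply: rpredZ; apply: dhomogMn.
have yE z : (a' ^+ d - lam *: a ^+ d').@[z] = 0 ->
    (a'.@[z]) ^+ d = lam * (a.@[z]) ^+ d'.
  by rewrite mevalB mevalZ !rmorphXn /= => /eqP; rewrite subr_eq0 => /eqP.
split=> z zy.
  have zL p : p \in L -> p.@[z] = 0 by move=> pL; apply: zy; rewrite inE pL orbT.
  have az' := yE z (zy _ (mem_head _ _)).
  apply: sL => p; rewrite inE => /orP [/eqP ->|/zL //].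
  apply/eqP; apply: contraTT qlam => az; rewrite negbK.
  have := gen_eval0 zL Lc; rewrite rmorph_sum /=.
  have -> : \sum_(i < e.+1)
     (c i *: ((a ^+ d') ^+ i * (a' ^+ d) ^+ (e - i))).@[z] =
     (a.@[z] ^+ d') ^+ e * q.[lam].
    rewrite horner_poly mulr_sumr [RHS](reindex_inj rev_ord_inj) /=.
    apply: eq_bigr => i _; rewrite subSS.
    have ie : (i <= e)%N by rewrite -ltnS.
    rewrite subKn // inord_val mevalZ mevalM !rmorphXn /= az' exprMn.
    have -> : (a.@[z] ^+ d') ^+ e = (a.@[z] ^+ d') ^+ i * (a.@[z] ^+ d') ^+ (e - i).
    by rewrite -exprD subnKC.
  by ring.
  by move=> /eqP; rewrite mulf_eq0 !expf_eq0 (negPf az) !andbF.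
have zL p : p \in L' -> p.@[z] = 0 by move=> pL; apply: zy; rewrite inE pL orbT.
have az' := yE z (zy _ (mem_head _ _)).
apply: sL' => p; rewrite inE => /orP [/eqP ->|/zL //].
have [az|az] := eqVneq a.@[z] 0.
  by move: az' => /eqP; rewrite az expr0n eqn0Ngt d'0 mulr0 expf_eq0 d0 => /eqP.
apply/eqP; apply: contraTT q'lam => _; rewrite negbK.
have := gen_eval0 zL Lc'; rewrite rmorph_sum /=.
have -> : \sum_(i < e'.+1)
   (c' i *: ((a' ^+ d) ^+ i * (a ^+ d') ^+ (e' - i))).@[z] =
   (a.@[z] ^+ d') ^+ e' * q'.[lam].
  rewrite horner_poly mulr_sumr.
  apply: eq_bigr => i _.
  have ie : (i <= e')%N by rewrite -ltnS.
  rewrite inord_val mevalZ mevalM !rmorphXn /= az' exprMn.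
  have -> : (a.@[z] ^+ d') ^+ e' = (a.@[z] ^+ d') ^+ i * (a.@[z] ^+ d') ^+ (e' - i).
    by rewrite -exprD subnKC.
  by ring.
by move=> /eqP; rewrite mulf_eq0 !expf_eq0 (negPf az) !andbF.
Qed.

(** Two systems with the common part [r] are compared through two systems that
    share one more element [y]. *)
Lemma reg_link l l' r : size l = size l' -> hpos (l ++ r) -> hpos (l' ++ r) ->
  sop (l ++ r) -> sop (l' ++ r) -> reg (l' ++ r) -> reg (l ++ r).
Proof.
elim: l l' r => [|a l IH] [|a' l'] // r [sz] hl hl' sl sl' rl'.
have hlr : hpos (l ++ r) by apply: hpos_sub hl => x; rewrite inE orbC => ->.
have hlr' : hpos (l' ++ r) by apply: hpos_sub hl' => x; rewrite inE orbC => ->.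
have [d d0 ha] := hl a (mem_head _ _).
have [d' d'0 ha'] := hl' a' (mem_head _ _).
have [y [e e0 hy] [syl syl']] :=
  common_parameter hlr hlr' d0 d'0 ha ha' sl sl'.
have hyl : hpos (y :: l ++ r).
  by move=> p; rewrite inE => /orP [/eqP ->|/hlr //]; exists e.
have hyl' : hpos (y :: l' ++ r).
  by move=> p; rewrite inE => /orP [/eqP ->|/hlr' //]; exists e.
have [N' cN'] := sop_cofinite syl'.
have [N cN] := sop_cofinite sl.
have ryl' : reg (l' ++ y :: r).
  case: rl' => ra' rl'; apply/reg_move => //; split=> //.
  exact: (nzd_exchange (graded_gen hlr') ha' hy d'0 e0 ra' cN').
have pe l0 : perm_eq (l0 ++ y :: r) (y :: l0 ++ r).
  exact/permPl/(perm_catCA l0 [:: y]).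
have [ry rl] : reg (y :: l ++ r).
  apply/reg_move => //; apply: (IH l') => //.
  - by apply: hpos_sub hyl => x; rewrite (perm_mem (pe l)).
  - by apply: hpos_sub hyl' => x; rewrite (perm_mem (pe l')).
  - by move=> z zl; apply: syl => p pl; apply: zl; rewrite (perm_mem (pe l)).
  - by move=> z zl; apply: syl' => p pl; apply: zl; rewrite (perm_mem (pe l')).
split=> //; exact: (nzd_exchange (graded_gen hlr) hy ha e0 d0 ry cN).
Qed.

(** The Cohen-Macaulay property of the polynomial ring, transported from the
    variables. *)
Theorem sop_regular l : size l = n -> hpos l -> sop l -> reg l.
Proof.
move=> sl hl sopl; rewrite -[l]cats0.
pose vars := [seq 'X_i : A | i <- enum 'I_n].
apply: (@reg_link l vars [::]); rewrite ?cats0 //.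
- by rewrite sl size_map size_enum_ord.
- move=> p /mapP [i _ ->]; exists 1%N => //; rewrite dhomogX.
  by apply/eqP; apply: mdeg1.
- move=> z zv i; rewrite -[z i]mevalXU; apply: zv.
  by apply: map_f; rewrite mem_enum.
exact: reg_variables.
Qed.

End RegularSystemsOfParameters.

(** * Order of vanishing and power products *)

Section OrderOfVanishing.
Variables (K : fieldType) (n : nat).
Local Notation A := {mpoly K[n]}.

(** The [R]-th power of the maximal ideal of the origin. *)
Definition ord R (p : A) := forall m, m \in msupp p -> (R <= mdeg m)%N.

Lemma ord_ideal R : ideal (ord R).
Proof.
split=> [m|x y ox oy m|a x ox m].
- by rewrite msupp0.
- by move=> /msuppD_le; rewrite mem_cat => /orP [/ox|/oy].
- move=> /msuppM_le /allpairsP [[m1 m2] [_ /ox h ->]].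
  by rewrite mdegD (leq_trans h) // leq_addl.
Qed.

Lemma ord_zero R : ord R 0.
Proof. exact: ideal0 (ord_ideal R). Qed.

Lemma ordM a b p q : ord a p -> ord b q -> ord (a + b) (p * q).
Proof.
move=> op oq m /msuppM_le /allpairsP [[m1 m2] [/op h1 /oq h2 ->]].
by rewrite mdegD leq_add.
Qed.

Lemma ord_le a b p : (a <= b)%N -> ord b p -> ord a p.
Proof. by move=> ab op m /op; apply: leq_trans. Qed.

Lemma ord_trivial p : ord 0 p. Proof. by []. Qed.

Lemma ordX m : ord (mdeg m) 'X_[m].
Proof. by move=> m' /mem_msuppXP <-. Qed.

Lemma ordP R p : ord R p <-> forall m, (mdeg m < R)%N -> p@_m = 0.
Proof.
split=> op m.
  move=> mR; apply/eqP; rewrite mcoeff_eq0; apply: contraL mR => /op.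
  by rewrite -leqNgt.
by rewrite mcoeff_msupp leqNgt; apply: contra_neqN => /op.
Qed.

Lemma ord1P p : ord 1 p <-> p@_0%MM = 0.
Proof.
rewrite ordP; split=> [|p0 m]; first by apply; rewrite mdeg0.
by rewrite ltnS leqn0 mdeg_eq0 => /eqP ->.
Qed.

Lemma mcoeff0_eval (p : A) : p@_0%MM = p.@[fun=> 0].
Proof.
elim/mpolyind: p => [|c m p _ _ IH]; first by rewrite mcoeff0 meval0.
rewrite mcoeffD mevalD IH mcoeffZ mevalZ mcoeffX mevalX; congr (_ * _ + _).
have [->|m0] := eqVneq m 0%MM.
  by rewrite big1 // => i _; rewrite mnm0E expr0.
have [i mi] : exists i, m i != 0%N.
  apply/existsP; apply: contraNT m0; rewrite negb_exists => /forallP h.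
  by apply/eqP/mnmP => i; rewrite mnm0E; apply/eqP; rewrite -[_ == _]negbK.
by rewrite (bigD1 i) //= expr0n (negPf mi) mul0r.
Qed.

Lemma split_degree R (p : A) : exists2 c : 'X_{1..n < R} -> K,
  True & ord R (p - \sum_m c m *: 'X_[m]).
Proof.
exists (fun m => p@_m) => //; apply/ordP => m mR.
by rewrite mcoeffB (mcoeff_mpoly (fun m => p@_m)) // subrr.
Qed.

End OrderOfVanishing.

Arguments ord_ideal {K n} R.

Section PowerProducts.
Variables (A : comNzRingType) (n : nat) (f : 'I_n -> A).

Definition fpow (a : 'X_{1..n}) : A := \prod_i f i ^+ a i.

Lemma fpowD a b : fpow (a + b)%MM = fpow a * fpow b.
Proof.
rewrite /fpow -big_split; apply: eq_bigr => i _.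
by rewrite mnmDE exprD.
Qed.

Lemma fpow1 i : fpow U_(i)%MM = f i.
Proof.
rewrite /fpow (bigD1 i) //= mnm1E eqxx expr1 big1 ?mulr1 // => j ji.
by rewrite mnm1E eq_sym (negPf ji).
Qed.

Lemma fpow0 : fpow 0%MM = 1.
Proof. by rewrite /fpow big1 // => i _; rewrite mnm0E. Qed.

End PowerProducts.

Lemma submonomial n (a : 'X_{1..n}) s : (s <= mdeg a)%N ->
  exists2 b : 'X_{1..n}, mdeg b = s & (b <= a)%MM.
Proof.
move=> sa; elim: s sa => [|s IH] sa.
  by exists 0%MM; [exact: mdeg0 | apply/mnm_lepP => i; rewrite mnm0E].
have [b bs ba] := IH (ltnW sa).
have [i bai] : exists i, (b i < a i)%N.
  apply/existsP; apply: contraLR sa; rewrite negb_exists => /forallP h.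
  by rewrite -ltnNge ltnS -bs !mdegE leq_sum // => i _; rewrite leqNgt.
exists (b + U_(i))%MM; first by rewrite mdegD mdeg1 bs addn1.
apply/mnm_lepP => j; rewrite mnmDE mnm1E.
case: eqVneq => [<-|_]; first by rewrite addn1.
by rewrite addn0; apply/mnm_lepP.
Qed.

(** One of the exponents is less than [mdeg g]; the others are less than [R]. *)
Lemma card_not_above n R (g : 'X_{1..n}) :
  (#|[pred a : 'X_{1..n < R} | ~~ (g <= a)%MM]| <= n * mdeg g * R ^ n.-1)%N.
Proof.
pose E i := [set x : {ffun 'I_n -> 'I_R} | (x i < mdeg g)%N].
have bm (a : 'X_{1..n < R}) i : (a i < R)%N.
  by apply: leq_ltn_trans (bmdeg a); rewrite mdegE (bigD1 i) //= leq_addr.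
pose h (a : 'X_{1..n < R}) := [ffun i => Ordinal (bm a i)].
have h_inj : injective h.
  move=> a b /ffunP ab; apply/val_inj/mnmP => i.
  by have := ab i; rewrite !ffunE => -[].
rewrite -(fintype.card_image h_inj).
have : {subset fintype.image h [pred a : 'X_{1..n < R} | ~~ (g <= a)%MM]
    <= \bigcup_i E i}.
  move=> x /fintype.imageP [a]; rewrite inE => ga ->.
  have /existsP [i gi] : [exists i, ~~ (g i <= a i)%N].
    rewrite -negb_forall; apply: contra ga => /forallP ga.
    by apply/mnm_lepP.
  apply/finset.bigcupP; exists i => //; rewrite inE ffunE /=.
  by rewrite -ltnNge in gi; rewrite (leq_trans gi) // mdegE (bigD1 i) //= leq_addr.
move=> /fintype.subsetP/subset_leq_card/leq_trans; apply.
have cardU : (#|\bigcup_i E i| <= \sum_i #|E i|)%N.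
  elim/big_ind2: _ => [|k S k' S' Sk Sk'|//]; first by rewrite cards0.
  by apply: (leq_trans (leq_of_leqif (leq_card_setU S S'))); rewrite leq_add.
apply: leq_trans cardU _.
apply: (@leq_trans (\sum_(i < n) mdeg g * R ^ n.-1)).
  apply: leq_sum => i _.
  pose F j := if j == i then [pred y : 'I_R | (y < mdeg g)%N] else predT.
  have -> : #|E i| = #|family F|.
    apply: eq_card => x; rewrite inE; apply/idP/familyP => [xi j|/(_ i)].
      by rewrite /F; case: eqVneq => // ->.
    by rewrite /F eqxx.
  rewrite card_family foldrE big_map big_enum /= (bigD1 i) //=.
  apply: leq_mul.
    rewrite /F eqxx;
    rewrite cardE -(size_map val) -[X in (_ <= X)%N](size_iota 0 (mdeg g)).
    apply: uniq_leq_size.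
      by rewrite map_inj_uniq ?enum_uniq //; apply: val_inj.
    move=> y /mapP [z]; rewrite mem_enum inE => zg ->.
    by rewrite mem_iota.
  rewrite (eq_bigr (fun=> R)); last first.
    by move=> j ji; rewrite /F (negPf ji) card_ord.
  by rewrite prod_nat_const cardC1 card_ord.
by rewrite sum_nat_const card_ord mulnA.
Qed.

(** * Quasi-regularity at an isolated zero *)

Section QuasiRegularity.
Variables (K : fieldType) (n : nat) (f : 'I_n -> {mpoly K[n]}).
Local Notation A := {mpoly K[n]}.
Hypothesis n_gt0 : (0 < n)%N.
Hypothesis f0 : forall i, ord 1 (f i).

Local Notation J := (gen [seq f i | i <- enum 'I_n]).

Lemma ord_fpow a : ord (mdeg a) (fpow f a).
Proof.
rewrite /fpow mdegE.
elim/big_ind2: _ => [|x1 x2 y1 y2|i _]; first exact: ord_trivial.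
  by move=> o1 o2; apply: ordM.
elim: (a i) => [|k IH]; first exact: ord_trivial.
by rewrite exprS -add1n; apply: ordM.
Qed.

Section Relation.
Variables (N : nat) (g : 'X_{1..n} -> A) (M : nat) (c : 'X_{1..n}).
Hypothesis m_primary :
  forall R p, ord N p -> exists2 q, J q & ord R (p - q).
Hypothesis g_rel : \sum_(a : 'X_{1..n < M}) g a * fpow f a = 0.
Hypothesis g_low : forall a, (mdeg a < mdeg c)%N -> g a = 0.
Hypothesis c_lt : (mdeg c < M)%N.
Hypothesis g_c : (g c)@_0%MM != 0.
Hypothesis c_max : forall a : 'X_{1..n < M}, mdeg a = mdeg c ->
  (g a)@_0%MM != 0 -> ((a : 'X_{1..n}) <= c)%O.

Let TL s : seq A := [seq fpow f a | a <- [seq bmnm a | a <- enum {: 'X_{1..n < s.+1}}]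
  & (mdeg a == s) && ~~ (c <= a)%MM].
Let ML i s : seq A := [seq 'X_[b] * fpow f a
  | b <- [seq b <- [seq bmnm b | b <- enum {: 'X_{1..n < i.+1}}] | mdeg b == i],
    a <- [seq a <- [seq bmnm a | a <- enum {: 'X_{1..n < s.+1}}] | mdeg a == s]].
(** The power products of degree [s] that are not multiples of [f^c], together
    with [m^i] times all power products of degree [s], where [m] is the maximal
    ideal of the origin. *)
Let G i s := gen (TL s ++ ML i s).

Let enum_mnm s (a : 'X_{1..n}) : mdeg a = s ->
  a \in [seq bmnm a | a <- enum {: 'X_{1..n < s.+1}}].
Proof.
move=> sa; have sa' : (mdeg a < s.+1)%N by rewrite sa.
by apply/mapP; exists (BMultinom sa'); rewrite ?mem_enum.
Qed.

Let mem_TL s a : mdeg a = s -> ~~ (c <= a)%MM -> fpow f a \in TL s.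
Proof.
move=> sa ca; apply: map_f; rewrite mem_filter sa eqxx ca /=.
exact: enum_mnm.
Qed.

Let mem_ML i s b a : mdeg b = i -> mdeg a = s -> 'X_[b] * fpow f a \in ML i s.
Proof.
move=> ib sa; apply/allpairsP; exists (b, a); split=> //=.
  by rewrite mem_filter ib eqxx enum_mnm.
by rewrite mem_filter sa eqxx enum_mnm.
Qed.

Let idG i s : ideal (G i s). Proof. exact: ideal_gen. Qed.

Let GM i s p a : ord i p -> mdeg a = s -> G i s (p * fpow f a).
Proof.
move=> op sa; rewrite [p]mpolyE mulr_suml big_seq.
apply: (ideal_sum (idG i s)) => m /op im.
have [b bi bm] := submonomial im.
have -> : m = (b + (m - b))%MM by rewrite addmC submK.
rewrite mpolyXD scalerAr -mulrA mulrCA; apply: idealM => //.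
by apply: mem_gen; rewrite mem_cat mem_ML ?orbT.
Qed.

(** A power product of higher degree has a surplus factor in [m]. *)
Let GM1 s a : (s < mdeg a)%N -> G 1 s (fpow f a).
Proof.
move=> sa; have [b bs ba] := submonomial (ltnW sa).
have -> : a = ((a - b) + b)%MM by rewrite submK.
rewrite fpowD; apply: GM => //.
apply: (@ord_le _ _ 1 (mdeg (a - b)%MM)); last exact: ord_fpow.
rewrite lt0n mdeg_eq0.
apply: contraTneq sa => ab0; rewrite -leqNgt -bs.
by rewrite -(submK ba) ab0 add0m.
Qed.

(** The relation, multiplied by [f^(a - c)], expresses [f^a] by smaller power
    products of the same degree up to multiples by elements of [m]. *)
Let G1 s a : mdeg a = s -> G 1 s (fpow f a).
Proof.
elim/(well_founded_ind (@ltom_wf n)): a => a IH sa.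
have [ca|ca] := boolP (c <= a)%MM; last first.
  by apply: mem_gen; rewrite mem_cat mem_TL.
pose d := (a - c)%MM.
have ad : a = (c + d)%MM by rewrite addmC submK.
have : G 1 s (((g c)@_0%MM)%:MP * fpow f a).
  have : ((g c)@_0%MM)%:MP * fpow f a = - \sum_(b : 'X_{1..n < M} | b != BMultinom c_lt)
      g b * fpow f (b + d)%MM - (g c - ((g c)@_0%MM)%:MP) * fpow f a.
    set S := \sum_(_ | _) _; move: (congr1 (fun x => x * fpow f d) g_rel).
    rewrite mul0r (bigD1 (BMultinom c_lt)) //= mulrDl -mulrA -fpowD -ad.
    rewrite mulr_suml; have -> : \sum_(b | b != BMultinom c_lt)
        g b * fpow f b * fpow f d = S.
      by apply: eq_bigr => b _; rewrite fpowD mulrA.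
    by move=> /eqP; rewrite addrC addr_eq0 => /eqP ->; ring.
  move=> ->; apply: idealB => //; last first.
    by apply: GM => //; apply/ord1P; rewrite mcoeffB mcoeffC eqxx mulr1 subrr.
  apply: idealN => //; apply: ideal_sum => // b bc.
  have [blt|cb] := ltnP (mdeg b) (mdeg c).
    by rewrite g_low // mul0r; apply: ideal0.
  have sE : s = (mdeg c + mdeg d)%N by rewrite -mdegD -ad.
  move: cb; rewrite leq_eqVlt => /orP [/eqP cb|cb]; last first.
    by apply: idealM => //; apply: GM1; rewrite mdegD sE ltn_add2r.
  have sb : mdeg (b + d)%MM = s by rewrite mdegD -cb.
  have [gb|gb] := eqVneq ((g b)@_0%MM) 0.
    by apply: GM => //; apply/ord1P.
  apply: idealM => //; apply: IH => //.
  rewrite ad ltmc_add2l lt_neqAle c_max // andbT.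
  by apply: contra_neq bc => bc; apply: val_inj.
move=> /(idealM (idG 1 s) ((g c)@_0%MM)^-1%:MP).
by rewrite mulrA -mpolyCM mulVf // mpolyC1 mul1r.
Qed.

(** Iterating [G1] as in the proof of Nakayama's lemma. *)
Let Gi i s a : mdeg a = s -> G i s (fpow f a).
Proof.
elim: i a => [|i IH] a sa.
  by rewrite -[fpow f a]mul1r -mpolyX0; apply: mem_gen; rewrite mem_cat mem_ML ?orbT ?mdeg0.
have GS b : mdeg b = i -> forall p, G 1 s p -> G i.+1 s ('X_[b] * p).
  move=> bi; apply: gen_sub.
    split=> [|x y Gx Gy|x y Gy]; first by rewrite mulr0; apply: ideal0.
      by rewrite mulrDr; apply: idealD.
    by rewrite mulrCA; apply: idealM.
  move=> x; rewrite mem_cat => /orP [xT|].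
    by apply: idealM => //; apply: mem_gen; rewrite mem_cat xT.
  move=> /allpairsP [[b1 a1] [/= b1i a1s ->]].
  rewrite mulrA -mpolyXD; apply: mem_gen; rewrite mem_cat mem_ML ?orbT //.
    move: b1i; rewrite mem_filter => /andP [/eqP b1i _].
    by rewrite mdegD bi b1i addn1.
  by move: a1s; rewrite mem_filter => /andP [/eqP].
move: (IH a sa); apply: gen_sub => // x; rewrite mem_cat => /orP [xT|].
  by apply: mem_gen; rewrite mem_cat xT.
move=> /allpairsP [[b1 a1] [/= b1i a1s ->]].
move: b1i a1s; rewrite !mem_filter => /andP [/eqP b1i _] /andP [/eqP a1s _].
by apply: GS => //; apply: G1.
Qed.

Let idx R := {x : 'X_{1..n < N} * 'X_{1..n < R} | ~~ (c <= x.2)%MM}.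
Let gensys R (x : idx R) : A := 'X_[(val x).1] * fpow f (val x).2.
Let SP R (p : A) := exists e : idx R -> K, ord R (p - \sum_x e x *: gensys x).

Let SP_ord R p : ord R p -> SP R p.
Proof.
move=> op; exists (fun=> 0); rewrite big1 ?subr0 // => x _.
by rewrite scale0r.
Qed.

Let SP_add R p q : SP R p -> SP R q -> SP R (p + q).
Proof.
move=> [e oe] [e' oe']; exists (fun x => e x + e' x).
have := idealD (ord_ideal R) oe oe'; rewrite addrACA -opprD -big_split /=.
by congr (ord R (_ - _)); apply: eq_bigr => x _; rewrite scalerDl.
Qed.

Let SP_sum R (T : finType) (F : T -> A) :
  (forall t, SP R (F t)) -> SP R (\sum_t F t).
Proof.
move=> SF; apply: big_ind => [|x y|t _] //; last exact: SP_add.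
by apply: SP_ord; apply: ord_zero.
Qed.

Let SP_gen R (k : K) (x : idx R) : SP R (k *: gensys x).
Proof.
exists (fun y => if y == x then k else 0).
rewrite (bigD1 x) //= eqxx big1 ?addr0 ?subrr; first exact: ord_zero.
by move=> y /negPf ->; rewrite scale0r.
Qed.

(** Coefficients are reduced modulo [m^N], which is in [J] up to high order; the
    resulting elements of [J] raise the degree of the power product, until it
    reaches [R]. *)
Let SP_fpow R t a p : (R <= mdeg a + t)%N -> SP R (p * fpow f a).
Proof.
elim: t a p => [|t IH] a p.
  rewrite addn0 => Ra; apply: SP_ord; apply: (idealM (ord_ideal R)).
  by apply: (@ord_le _ _ _ (mdeg a)) => //; apply: ord_fpow.
rewrite addnS leq_eqVlt => /orP [/eqP RE|]; last by rewrite ltnS; apply: IH.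
move: (@Gi R (mdeg a) a (erefl _)) p.
pose I q := forall p, SP R (p * q).
have idI : ideal I.
  split=> [p|x y Ix Iy p|x y Iy p].
  - by rewrite mulr0; apply/SP_ord/ord_zero.
  - by rewrite mulrDr; apply: SP_add.
  - by rewrite mulrA; apply: Iy.
apply: (gen_sub idI) => x; rewrite mem_cat => /orP [/mapP [b]|].
  rewrite mem_filter => /andP [/andP [/eqP bs cb] _] -> p.
  have [k _ ok] := split_degree N p.
  have [q Jq oq] := m_primary R ok.
  set v := \sum_m k m *: 'X_[m] in ok oq.
  have -> : p * fpow f b = v * fpow f b + q * fpow f b + (p - v - q) * fpow f b.
    by ring.
  apply: SP_add; last first.
    by apply: SP_ord; apply: (idealMr (ord_ideal R)).
  apply: SP_add.
    rewrite /v mulr_suml; apply: SP_sum => m; rewrite -scalerAl.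
    have bR : (mdeg b < R)%N by rewrite RE bs; lia.
    pose x0 := (m, BMultinom bR).
    have cx0 : ~~ (c <= x0.2)%MM by [].
    exact: (SP_gen (k m) (exist _ x0 cx0 : idx R)).
  pose I' q := forall p', SP R (p' * q * fpow f b).
  rewrite -[q]mul1r; move: Jq 1; apply: (@gen_sub _ I').
    split=> [p'|y z Iy Iz p'|y z Iz p'].
    - by rewrite mulr0 mul0r; apply/SP_ord/ord_zero.
    - by rewrite mulrDr mulrDl; apply: SP_add.
    - by rewrite mulrA; apply: Iz.
  move=> y /mapP [i _ ->] p'; rewrite -mulrA -fpow1 -fpowD; apply: IH.
  by rewrite mdegD mdeg1 RE bs; lia.
move=> /allpairsP [[b1 a1] [/= b1i _ ->]] p.
move: b1i; rewrite mem_filter => /andP [/eqP b1i _].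
apply: SP_ord; apply: (idealM (ord_ideal R)).
by apply: (idealMr (ord_ideal R)); rewrite -b1i; apply: ordX.
Qed.

(** The relation makes the power products [f^a] with [c <= a] redundant, so that
    the quotients [A / m^R] would be generated by a number of elements that
    grows like [R^(n-1)], whereas their dimensions grow like [R^n]. *)
Lemma relation_absurd : False.
Proof.
(* [Q^n] exceeds the number of generators of [A / m^(n Q)] *)
pose Q := (#|{: 'X_{1..n < N}}| * (n * mdeg c) * n ^ n.-1).+1.
pose R := (n * Q)%N.
pose v (x : {ffun 'I_n -> 'I_Q}) : A := 'X_[[multinom x i : nat | i < n]].
have : (#|{ffun 'I_n -> 'I_Q}| <= #|{: idx R}|)%N.
  apply: (steinitz (ideal_subspace (@ord_ideal K n R)) (v := v)
    (w := @gensys R)) => [e oe x|x]; last first.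
    have [e oe] := @SP_fpow R R 0%MM (v x) (leq_addl _ _).
    by exists e; move: oe; rewrite fpow0 mulr1.
  have /ordP/(_ [multinom x i : nat | i < n]) := oe.
  rewrite raddf_sum (bigD1 x) //= mcoeffZ mcoeffX eqxx mulr1 big1 ?addr0.
    apply; rewrite mdegE; under eq_bigr do rewrite mnmE.
    apply: (@leq_ltn_trans (\sum_(i < n) Q.-1)).
      by apply: leq_sum => i _; rewrite -ltnS.
    by rewrite sum_nat_const card_ord ltn_mul2l n_gt0 /=.
  move=> y yx; rewrite mcoeffZ mcoeffX; case: eqVneq => [/mnmP yxE|]; last first.
    by rewrite mulr0.
  case/eqP: yx; apply/ffunP => i; apply/val_inj.
  by have := yxE i; rewrite !mnmE.
rewrite card_ffun !card_ord card_sig.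
have -> : #|[pred x : 'X_{1..n < N} * 'X_{1..n < R} | ~~ (c <= x.2)%MM]| =
   (#|{: 'X_{1..n < N}}| * #|[pred a : 'X_{1..n < R} | ~~ (c <= a)%MM]|)%N.
  by rewrite -cardX; apply: eq_card => x; rewrite !inE.
have := card_not_above R c; set X := #|_|; set Y := #|_| => XY QX.
have {QX XY} : (Q ^ n <= Y * (n * mdeg c * R ^ n.-1))%N.
  by apply: leq_trans QX _; rewrite leq_mul2l XY orbT.
rewrite leqNgt => /negP; apply.
rewrite /R expnMn -[X in (_ < _ ^ X)%N](prednK n_gt0) expnS.
rewrite mulnA mulnA mulnA ltn_pmul2r; last by rewrite expn_gt0.
by rewrite /Q ltnS !mulnA.
Qed.

End Relation.

End QuasiRegularity.

Section IsolatedZero.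
Variables (K : fieldType) (n : nat) (f : 'I_n -> {mpoly K[n]}).
Local Notation A := {mpoly K[n]}.
Hypothesis n_gt0 : (0 < n)%N.
Variables (z : 'I_n -> K) (u : A).
Hypothesis fz : forall i, (f i).@[z] = 0.
Hypothesis uz : u.@[z] = 1.
Hypothesis u_isolates : forall i, exists k,
  gen [seq f i | i <- enum 'I_n] ((u * ('X_i - (z i)%:MP)) ^+ k).

Let tau : {rmorphism A -> A} := comp_mpoly [tuple 'X_i + (z i)%:MP : A | i < n].

Let tau_eval p : (tau p)@_0%MM = p.@[z].
Proof.
rewrite mcoeff0_eval /tau /= comp_mpoly_meval; apply: meval_eq => i.
by rewrite tnth_mktuple mevalD mevalXU mevalC add0r.
Qed.

Let tauX i : tau ('X_i - (z i)%:MP) = 'X_i.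
Proof.
rewrite /tau rmorphB /= comp_mpolyXU comp_mpolyC -tnth_nth tnth_mktuple.
by rewrite addrK.
Qed.

Local Notation J := (gen [seq tau (f i) | i <- enum 'I_n]).

Let gen_tau p : gen [seq f i | i <- enum 'I_n] p -> J (tau p).
Proof.
apply: (@gen_sub _ (fun p => J (tau p))).
  split=> [|x y Jx Jy|x y Jy].
  - by rewrite rmorph0; apply: (ideal0 (ideal_gen _)).
  - by rewrite rmorphD; apply: (idealD (ideal_gen _)).
  - by rewrite rmorphM; apply: (idealM (ideal_gen _)).
move=> x /mapP [i _ ->]; apply: mem_gen.
by apply: (map_f (fun i => tau (f i))); rewrite mem_enum.
Qed.

(** With [mu = 1 - u^k] vanishing at the origin, [X_i^k] is [(u X_i)^k] plus
    [mu X_i^k], and this may be substituted into itself. *)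
Let approx R i k : J ((tau u * 'X_i) ^+ k) ->
  exists2 q, J q & ord R ('X_i ^+ k - q).
Proof.
move=> Juk; have idJ : ideal J := ideal_gen _.
have [q Jq [b ob ->]] : exists2 q, J q & exists2 b, ord R b &
    'X_i ^+ k = q + b * 'X_i ^+ k.
  elim: R => [|R [q Jq [b ob E]]].
    exists 0; first exact: ideal0.
    by exists 1 => //; rewrite add0r mul1r.
  exists (q + b * (tau u * 'X_i) ^+ k); first by apply: idealD => //; apply: idealM.
  exists (b * (1 - tau u ^+ k)).
    rewrite -addn1; apply: ordM => //; apply/ord1P.
    by rewrite -[1](rmorph1 tau) -rmorphXn -rmorphB tau_eval mevalB rmorphXn
      /= uz expr1n meval1 subrr.
  by rewrite {1}E exprMn; ring.
by exists q => //; rewrite addrAC subrr add0r; apply: (idealMr (ord_ideal R)).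
Qed.

(** The translation [tau] moves [z] to the origin.  Since [u] is a unit near [z],
    the powers of [u * (X_i - z_i)] in the ideal show that it contains a power of
    the maximal ideal up to any order, which is the input of [relation_absurd];
    [c] is a maximal exponent with a coefficient that does not vanish at [z]. *)
Lemma quasi_regular (g : 'X_{1..n} -> A) M r :
    \sum_(a : 'X_{1..n < M}) g a * fpow f a = 0 ->
    (forall a, (mdeg a < r)%N -> g a = 0) ->
  forall c : 'X_{1..n < M}, mdeg c = r -> (g c).@[z] = 0.
Proof.
move=> grel glow c0 c0r; apply/eqP/negPn/negP => gc0.
pose P (a : 'X_{1..n < M}) := (mdeg a == r) && ((g a).@[z] != 0).
have Pc0 : P c0 by rewrite /P c0r eqxx.
have [c /andP [/eqP cr gc] cmax] :=
  Order.TotalTheory.arg_maxP (fun a : 'X_{1..n < M} => (a : 'X_{1..n})) Pc0.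
have /choice [k hk] := u_isolates.
pose N := (\sum_i k i).+1.
apply: (@relation_absurd K n (fun i => tau (f i)) n_gt0 _ N (fun a => tau (g a))
  M c) => //.
- by move=> i; apply/ord1P; rewrite tau_eval.
- move=> R p op; pose I p := exists2 q, J q & ord R (p - q).
  have idI : ideal I.
    split=> [|x y [q Jq oq] [q' Jq' oq']|x y [q Jq oq]].
    - exists 0; first exact: (ideal0 (ideal_gen _)).
      by rewrite subrr; apply: ord_zero.
    - exists (q + q'); first exact: (idealD (ideal_gen _)).
      by rewrite opprD addrACA; apply: (idealD (ord_ideal R)).
    - exists (x * q); first exact: (idealM (ideal_gen _)).
      by rewrite -mulrBr; apply: (idealM (ord_ideal R)).
  rewrite -/(I p) [p]mpolyE big_seq; apply: (ideal_sum idI) => m /op Nm.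
  rewrite -mul_mpolyC; apply: (idealM idI).
  have [i ->] := monomial_divides_power K Nm.
  apply: (idealMr idI); apply: approx.
  by rewrite -(tauX i) -rmorphM -rmorphXn; apply/gen_tau/hk.
- rewrite -[RHS](rmorph0 tau) -[in RHS]grel rmorph_sum.
  apply: eq_bigr => a _; rewrite rmorphM rmorph_prod; congr (_ * _).
  by apply: eq_bigr => i _; rewrite rmorphXn.
- by move=> a ar; rewrite glow ?rmorph0 // -cr.
- exact: bmdeg.
- by rewrite tau_eval.
- move=> a; rewrite tau_eval cr => ar ga; apply: cmax.
  by rewrite /P ar eqxx.
Qed.

End IsolatedZero.

Section FiniteZeroSet.
Variables (K : closedFieldType) (n : nat) (f : 'I_n -> {mpoly K[n]}).
Local Notation A := {mpoly K[n]}.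
Hypothesis K_big : big_fibres K.
Hypothesis n_gt0 : (0 < n)%N.
Variables (T : finType) (Z : T -> 'I_n -> K) (b : T -> A).
Hypothesis fZ : forall i t, (f i).@[Z t] = 0.
Hypothesis Z_all : forall z, (forall i, (f i).@[z] = 0) -> exists t, z =1 Z t.
Hypothesis bZ : forall t t', (b t).@[Z t'] = (t == t')%:R.

(** At each zero the lowest forms in the [f i] are detected by
    [quasi_regular], and the [b t] separate the zeros. *)
Lemma fpow_indep (c : 'X_{1..n} -> T -> K) M :
    \sum_(a : 'X_{1..n < M}) \sum_t c a t *: (fpow f a * b t) = 0 ->
  forall a : 'X_{1..n < M}, forall t, c a t = 0.
Proof.
move=> crel a; have [r ra] : exists r, mdeg a = r by exists (mdeg a).
elim/ltn_ind: r a ra => r IH a ra t.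
pose g (x : 'X_{1..n}) := if (mdeg x < M)%N then \sum_t c x t *: b t else 0.
have -> : c a t = (g a).@[Z t].
  rewrite /g bmdeg raddf_sum (bigD1 t) //= mevalZ bZ eqxx mulr1.
  rewrite big1 ?addr0 // => t' t't.
  by rewrite mevalZ bZ (negPf t't) mulr0.
apply: (@quasi_regular K n f n_gt0 (Z t) (b t) _ _ _ g M r) => //.
- by rewrite bZ eqxx.
- move=> i; apply: (nullstellensatz K_big); first exact: ideal_gen.
  move=> z zf; have /Z_all [t' zE] : forall i, (f i).@[z] = 0.
    by move=> j; apply/zf/mem_gen/map_f; rewrite mem_enum.
  rewrite mevalM mevalB mevalXU mevalC (meval_eq _ zE) bZ zE.
  by case: eqVneq => [->|_]; rewrite ?subrr ?mulr0 ?mul0r.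
- rewrite -[RHS]crel; apply: eq_bigr => x _; rewrite /g bmdeg mulr_suml.
  by apply: eq_bigr => t' _; rewrite -scalerAl mulrC.
move=> x xr; rewrite /g; case: ifP => // xM.
by rewrite big1 // => t' _; rewrite (IH _ xr (BMultinom xM)) // scale0r.
Qed.

End FiniteZeroSet.

(** * Counting monomials *)

Lemma card_mnm_homog n e :
  #|[pred m : 'X_{1..n.+1 < e.+1} | mdeg m == e]| = 'C(e + n, n).
Proof.
rewrite -(bin_sub (leq_addl e n)) addnK -(size_basis n e).
rewrite cardE -(size_map (@bmnm _ _)).
apply/perm_size/uniq_perm.
- by rewrite map_inj_uniq ?enum_uniq //; apply: val_inj.
- exact: uniq_basis.
move=> m; rewrite -basis_cover; apply/mapP/idP => [[x]|me].
  by rewrite mem_enum inE => xe ->.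
have me' : (mdeg m < e.+1)%N by rewrite (eqP me).
by exists (BMultinom me'); rewrite ?mem_enum.
Qed.

Lemma card_mnmS n d : #|{: 'X_{1..n < d.+1}}| =
  (#|{: 'X_{1..n < d}}| + #|[pred m : 'X_{1..n < d.+1} | mdeg m == d]|)%N.
Proof.
rewrite -[LHS](cardC [pred m : 'X_{1..n < d.+1} | (mdeg m < d)%N]); congr (_ + _)%N.
  have wid (m : 'X_{1..n < d}) : (mdeg m < d.+1)%N by apply: ltnW; apply: bmdeg.
  rewrite -(fintype.card_image (f := fun m => BMultinom (wid m))); last first.
    by move=> x y [] /val_inj.
  apply: eq_card => m; rewrite inE; apply/idP/fintype.imageP => [md|[x _ ->]].
    by exists (BMultinom md) => //; apply: val_inj.
  exact: (bmdeg x).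
apply: eq_card => m; have := bmdeg m; rewrite !inE ltnS -leqNgt => md.
by rewrite eqn_leq md.
Qed.

Lemma card_mnm n d : (0 < n)%N -> #|{: 'X_{1..n < d.+1}}| = 'C(d + n, n).
Proof.
case: n => // n _; elim: d => [|d IH]; rewrite card_mnmS card_mnm_homog.
  by rewrite !add0n !binn eq_card0 // => m; have := bmdeg m.
by rewrite IH [(d.+1 + n.+1)%N]addnS binS addSnnS.
Qed.

Lemma card_mnm_ge n Q : (0 < n)%N -> (Q ^ n <= #|{: 'X_{1..n < n * Q}}|)%N.
Proof.
move=> n0; rewrite -[n in (_ ^ n)%N]card_ord -[Q in (Q ^ _)%N]card_ord -card_ffun.
have bnd (x : {ffun 'I_n -> 'I_Q}) :
    (mdeg [multinom x i : nat | i < n] < n * Q)%N.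
  rewrite mdegE; under eq_bigr do rewrite mnmE.
  apply: (@leq_ltn_trans (\sum_(i < n) Q.-1)).
    by apply: leq_sum => i _; rewrite -ltnS (ltn_predK (ltn_ord (x i))).
  rewrite sum_nat_const card_ord ltn_mul2l n0 /=.
  by rewrite (ltn_predK (ltn_ord (x (Ordinal n0)))).
apply: (@leq_card _ _ (fun x => BMultinom (bnd x))) => x y /(congr1 (@bmnm _ _)) /mnmP xy.
by apply/ffunP => i; apply/val_inj; have := xy i; rewrite !mnmE.
Qed.

Lemma bin_shift x c n : ('C(x + c, n.+1) <= 'C(x, n.+1) + c * (x + c) ^ n)%N.
Proof.
have bin_le y : ('C(y, n) <= y ^ n)%N.
  apply: leq_trans (leq_pmulr _ (fact_gt0 n)) _; rewrite bin_ffact.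
  rewrite ffact_prod -[X in (_ <= _ ^ X)%N](card_ord n) -prod_nat_const.
  by apply: leq_prod => i _; rewrite leq_subr.
have mono y y' : (y <= y')%N -> (y ^ n <= y' ^ n)%N.
  by move=> yy'; case: (n) => // n'; rewrite leq_exp2r.
elim: c => [|c IH]; first by rewrite mul0n !addn0.
rewrite addnS binS mulSnr addnA; apply: leq_add.
  by apply: leq_trans IH _; rewrite leq_add2l leq_mul2l mono ?orbT.
by apply: leq_trans (bin_le _) _; apply: mono.
Qed.

Lemma size_linear_power (R : idomainType) (p q : {poly R}) d :
  size p = 2%N -> q != 0 -> (d < size (p ^+ d * q)%R)%N.
Proof.
move=> p2 q0; have p0 : p != 0 by rewrite -size_poly_eq0 p2.
have pd0 : p ^+ d != 0 by rewrite expf_neq0.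
rewrite size_mul //; have := size_exp p d; rewrite p2 mul1n.
have := size_poly_eq0 (p ^+ d); rewrite (negPf pd0).
have := size_poly_eq0 q; rewrite (negPf q0).
by case: (size q) => // s _; case: (size _) => // t _ /= ->; rewrite addnS ltnS leq_addr.
Qed.

Lemma mcoeff_bounded_sum (R : nzRingType) n d (E : 'X_{1..n < d} -> R)
    (y : 'X_{1..n < d}) : (\sum_m E m *: 'X_[m])@_y = E y.
Proof.
rewrite raddf_sum (bigD1 y) //= mcoeffZ mcoeffX eqxx mulr1 big1 ?addr0 // => m my.
by rewrite mcoeffZ mcoeffX (negPf (contra_neq (@val_inj _ _ _ _ _) my)) mulr0.
Qed.

Lemma msizeM_bound (K : fieldType) n d e (p q : {mpoly K[n]}) : (msize p <= d.+1)%N -> (msize q <= e.+1)%N ->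
  (msize (p * q) <= (d + e).+1)%N.
Proof.
have [->|p0] := eqVneq p 0; first by rewrite mul0r msize0.
have [->|q0] := eqVneq q 0; first by rewrite mulr0 msize0.
by move=> pd qe; rewrite msizeM // -subn1 leq_subLR add1n -addSn -addnS leq_add.
Qed.

(** * Degree in a direction *)

Section SubstitutionAlongALine.
Variables (K : fieldType) (n : nat) (v : 'I_n -> K).
Local Notation A := {mpoly K[n]}.

(** The substitution of [x + t v] for [x], with [t] the outer variable: the size
    of [line p] measures the degree of [p] in the direction [v]. *)
Definition line : {rmorphism A -> {poly A}} :=
  mmap (@polyC A \o @mpolyC n K) (fun i => ('X_i : A)%:P + (v i)%:MP *: 'X).

Lemma size_prod_le (R : comNzRingType) (p q : {poly R}) d e :
  (size p <= d.+1)%N -> (size q <= e.+1)%N ->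
  (size (p * q)%R <= (d + e).+1)%N /\ (p * q)`_(d + e) = p`_d * q`_e.
Proof.
move=> pd qe; split.
  apply: leq_trans (size_polyMleq _ _) _.
  by have := leq_add pd qe; case: (size p + size q)%N => // s; rewrite addSn addnS !ltnS.
have de : (d < (d + e).+1)%N by rewrite ltnS leq_addr.
rewrite coefM (bigD1 (Ordinal de)) //= addKn big1 ?addr0 // => i.
rewrite -val_eqE /= neq_ltn => /orP [id|di].
  rewrite [q`_ _]nth_default ?mulr0 // (leq_trans qe) //; lia.
by rewrite nth_default ?mul0r // (leq_trans pd).
Qed.

Lemma line_monomial (m : 'X_{1..n}) :
  (size (line 'X_[m]) <= (mdeg m).+1)%N /\
  (line 'X_[m])`_(mdeg m) = (('X_[m] : A).@[v])%:MP.
Proof.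
rewrite /line /= mmapX mevalX /mmap1 mdegE rmorph_prod /=.
elim/big_ind3: _ => [|p d a q e b [pd pa] [qe qb]|i _].
- by rewrite size_poly1 coef1.
- by have [-> ->] := size_prod_le pd qe; rewrite pa qb.
rewrite rmorphXn /=; elim: (m i) => [|k [pd pa]].
  by rewrite !expr0 size_poly1 coef1.
have qd : (size (('X_i : A)%:P + (v i)%:MP *: 'X)%R <= 2)%N.
  apply: leq_trans (size_polyD _ _) _; rewrite geq_max.
  rewrite (leq_trans (size_polyC_leq1 _)) //.
  by rewrite (leq_trans (size_scale_leq _ _)) // size_polyX.
rewrite !exprS -add1n; have [-> ->] := size_prod_le qd pd.
by rewrite pa coefD coefC coefZ coefX /= add0r mulr1.
Qed.

Lemma lineZ (a : K) (q : A) : line (a *: q) = (a%:MP)%:P * line q.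
Proof. by rewrite -mul_mpolyC rmorphM /line /= mmapC. Qed.

(** Both properties are linear in [p] and hold for monomials. *)
Lemma line_size (p : A) d : (msize p <= d.+1)%N ->
  (size (line p) <= d.+1)%N /\
  (line p)`_d = ((pihomog mdeg d p).@[v])%:MP.
Proof.
move=> pd.
have hm (m : 'X_{1..n}) : (mdeg m <= d)%N -> (size (line 'X_[m]) <= d.+1)%N /\
    (line 'X_[m])`_d = ((pihomog mdeg d ('X_[m] : A)).@[v])%:MP.
  have [s c] := line_monomial m; rewrite pihomogX.
  rewrite leq_eqVlt; case: eqVneq => [<-|_ /= md] //.
  rewrite meval0 mpolyC0; split; first by rewrite (leq_trans s) // ltnW.
  by rewrite nth_default // (leq_trans s).
have -> : line p = \sum_(m : 'X_{1..n < d.+1}) ((p@_m)%:MP)%:P * line 'X_[m].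
  by rewrite {1}(mpolywE pd) rmorph_sum; apply: eq_bigr => m _; apply: lineZ.
split.
  apply: leq_trans (size_sum _ _ _) _; apply/bigmax_leqP => m _.
  by rewrite mul_polyC (leq_trans (size_scale_leq _ _)) // (hm m (bmdeg m)).1.
rewrite {2}(mpolywE pd) (raddf_sum (pihomog mdeg d)).
rewrite (raddf_sum (meval v)) (raddf_sum (@mpolyC n K)).
rewrite coef_sum; apply: eq_bigr => m _; have [_ mc] := hm m (bmdeg m).
by rewrite coefCM mc /= linearZ /= mevalZ mpolyCM.
Qed.

Lemma line_at0 (p : A) : (line p).[0] = p.
Proof.
apply/eqP; rewrite eq_sym -subr_eq0; apply/eqP.
apply: (@subst_mod K n (gen [::]) (horner_eval (0 : A) \o line)
  (ideal_gen [::])) => [c|i] /=.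
  by rewrite /horner_eval /line /= mmapC hornerC.
rewrite /horner_eval /line /= mmapX mmap1U hornerD hornerC hornerZ hornerX.
by rewrite mulr0 addr0 subrr.
Qed.

End SubstitutionAlongALine.

(** * Leading forms of a complete intersection *)

Section NoZeroAtInfinity.
Variables (K : closedFieldType) (n : nat) (f : 'I_n -> {mpoly K[n]}).
Local Notation A := {mpoly K[n]}.
Hypothesis K_big : big_fibres K.
Hypothesis n_gt0 : (0 < n)%N.
Variables (k : 'I_n -> nat) (D : nat) (Z : 'I_D -> 'I_n -> K) (b : 'I_D -> A).
Hypothesis k_gt0 : forall i, (0 < k i)%N.
Hypothesis f_deg : forall i, (msize (f i) <= (k i).+1)%N.
Hypothesis fZ : forall i t, (f i).@[Z t] = 0.
Hypothesis Z_all : forall z, (forall i, (f i).@[z] = 0) -> exists t, z =1 Z t.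
Hypothesis bZ : forall t t', (b t).@[Z t'] = (t == t')%:R.
Hypothesis D_eq : D = (\prod_i k i)%N.

Lemma fpow_bound (Q : nat -> A -> Prop) (w : 'I_n -> nat) : Q 0%N 1 ->
    (forall d e p q, Q d p -> Q e q -> Q (d + e)%N (p * q)) ->
    (forall i, Q (w i) (f i)) ->
  forall a : 'X_{1..n}, Q (\sum_i w i * a i)%N (fpow f a).
Proof.
move=> Q1 QM Qf a; rewrite /fpow.
elim/big_ind2: _ => [|p d q e Qp Qq|i _] //; first exact: QM.
elim: (a i) => [|j IH]; first by rewrite muln0.
by rewrite exprS mulnS; apply: QM.
Qed.

(** Division of exponents by [k] leaves [D] possible remainders, which may be used
    to number the zeros; monomials then index the products
    [f^(quo x) * b_(rem x)]. *)
Let quo (x : 'X_{1..n}) : 'X_{1..n} := [multinom (x i %/ k i)%N | i < n].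

Lemma remainder_exists : exists rem : 'X_{1..n} -> 'I_D,
  forall x y, quo x = quo y -> rem x = rem y -> x = y.
Proof.
pose B := {dffun forall i : 'I_n, 'I_(k i)}.
have cardB : #|{: B}| = D.
  by rewrite card_dep_ffun foldrE big_map big_enum D_eq; apply: eq_bigr => i _; rewrite card_ord.
have modk (x : 'X_{1..n}) i : (x i %% k i < k i)%N by rewrite ltn_mod.
pose r (x : 'X_{1..n}) : B := [ffun i => Ordinal (modk x i)].
exists (fun x => cast_ord cardB (enum_rank (r x))) => x y.
move=> /mnmP qxy /cast_ord_inj/enum_rank_inj/ffunP rxy; apply/mnmP => i.
have := qxy i; have := rxy i; rewrite !ffunE !mnmE => -[rE qE].
by rewrite (divn_eq (x i) (k i)) qE rE -divn_eq.
Qed.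

Let kap := (\sum_i k i)%N.

Let k_le i : (k i <= kap)%N.
Proof. by rewrite /kap (bigD1 i) //= leq_addr. Qed.

Let kap_gt0 : (0 < kap)%N.
Proof. by apply: leq_trans (k_gt0 (Ordinal n_gt0)) (k_le _). Qed.

Let c := (\sum_t msize (b t))%N.

Let b_deg t : (msize (b t) <= c.+1)%N.
Proof. by rewrite ltnW // ltnS /c (bigD1 t) //= leq_addr. Qed.

Let N d := #|{: 'X_{1..n < d}}|.

(** At a common zero [v] of the leading forms, every [f i] has degree less than
    [k i] in the direction [v].  Hence the independent elements
    [f^(quo x) * b_(rem x)] have small degree in the direction [v] and stay
    independent of the multiples of a high power of a variable [X_l] with
    [v l <> 0]. *)
Lemma zero_at_infinity_bound (v : 'I_n -> K) (l : 'I_n) rho : v l != 0 ->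
    (forall i, (pihomog mdeg (k i) (f i)).@[v] = 0) ->
  (N (kap * rho).+1 + N rho <= N (c + kap * rho).+1)%N.
Proof.
move=> vl fv; have [rem remP] := remainder_exists.
(* a bound for the degrees of the [g x] in the direction [v], because
   [k i - 1 <= (1 - 1 / kap) * k i] *)
pose e := (c + (kap.-1 * rho))%N.
pose g (x : 'X_{1..n}) : A := fpow f (quo x) * b (rem x).
have quo_deg (x : 'X_{1..n}) : (\sum_i k i * quo x i <= mdeg x)%N.
  by rewrite mdegE leq_sum // => i _; rewrite mnmE mulnC leq_divM.
have g_deg (x : 'X_{1..n < (kap * rho).+1}) : (msize (g x) <= (c + kap * rho).+1)%N.
  rewrite /g addnC; apply: leq_trans (_ : (\sum_i k i * quo x i + c).+1 <= _)%N.
    apply: msizeM_bound => //.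
    apply: (fpow_bound (Q := fun d p => (msize p <= d.+1)%N)) => //.
      by rewrite msize1.
    by move=> *; apply: msizeM_bound.
  rewrite ltnS leq_add2r (leq_trans (quo_deg x)) //.
  by rewrite -ltnS bmdeg.
have f_line i : (size (line v (f i)) <= (k i).-1.+1)%N.
  have [s h] := line_size v (f_deg i); rewrite prednK //.
  apply/leq_sizeP => j; rewrite leq_eqVlt => /orP [/eqP <-|kj].
    by rewrite h fv mpolyC0.
  by rewrite nth_default // (leq_trans s).
have g_line (x : 'X_{1..n < (kap * rho).+1}) : (size (line v (g x)) <= e.+1)%N.
  rewrite /g rmorphM.
  apply: leq_trans (_ : (\sum_i (k i).-1 * quo x i + c).+1 <= _)%N.
    apply: (size_prod_le _ _).1; last by case: (line_size v (b_deg (rem x))).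
    apply: (fpow_bound (Q := fun d p => (size (line v p) <= d.+1)%N)) => //.
      by rewrite rmorph1 size_poly1.
    by move=> d d' p q pd qd; rewrite rmorphM; case: (size_prod_le pd qd).
  rewrite ltnS addnC /e leq_add2l.
  have kx : (\sum_i k i * quo x i <= kap * rho)%N.
    by rewrite (leq_trans (quo_deg x)) // -ltnS bmdeg.
  rewrite -(leq_pmul2l kap_gt0) big_distrr /=.
  apply: (@leq_trans (\sum_i kap.-1 * (k i * quo x i))).
    apply: leq_sum => i _; rewrite !mulnA leq_mul2r; apply/orP; right.
    by have := k_gt0 i; have := k_le i; nia.
  rewrite -big_distrr /= mulnCA leq_mul2l kx orbT //.
pose w (x : 'X_{1..n < (kap * rho).+1} + 'X_{1..n < rho}) : A :=
  match x with inl x => g x | inr y => 'X_l ^+ e.+1 * 'X_[y] end.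
rewrite /N -card_sum.
apply: (steinitz (subspace0 A) (v := w)
  (w := fun m : 'X_{1..n < (c + kap * rho).+1} => 'X_[m] : A)) => [a a0|x]; last first.
  exists (fun m : 'X_{1..n < (c + kap * rho).+1} => (w x)@_m).
  apply/eqP; rewrite subr_eq0 -mpolywE //; case: x => [x|y] /=; first exact: g_deg.
  rewrite mpolyXn -mpolyXD msizeX ltnS mdegD mdegMn mdeg1 mul1n.
  by have := bmdeg y; have := kap_gt0; rewrite /e; nia.
move: a0; rewrite big_sumType /=.
set G := \sum_i _; set H := \sum_i _ => GH.
pose q := \sum_(y : 'X_{1..n < rho}) a (inr y) *: 'X_[y] : A.
have HE : H = 'X_l ^+ e.+1 * q.
  by rewrite /H /q mulr_sumr; apply: eq_bigr => y _; rewrite scalerAr.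
have q0 : q = 0.
  apply/eqP; apply: contraT => q_neq0.
  have lq : line v q != 0.
    by apply: contra_neq q_neq0 => lq; rewrite -(line_at0 v q) lq horner0.
  have lX : size (line v 'X_l) = 2%N.
    rewrite /line /= mmapX mmap1U addrC -mul_polyC size_MXaddC.
    by rewrite polyC_eq0 mpolyC_eq0 (negPf vl) size_polyC mpolyC_eq0 vl.
  have lH : (e.+1 < size (line v H))%N.
    rewrite HE rmorphM rmorphXn.
    exact: size_linear_power.
  have lG : (size (line v G) <= e.+1)%N.
    rewrite /G rmorph_sum.
    apply: leq_trans (size_sum _ _ _) _; apply/bigmax_leqP => x _.
    by rewrite lineZ mul_polyC (leq_trans (size_scale_leq _ _)).
  move: lH; rewrite ltnNge; move/eqP: GH; rewrite addr_eq0 => /eqP GH.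
  by rewrite -[H]opprK -GH rmorphN size_polyN lG.
have a_inr y : a (inr y) = 0.
  have := congr1 (mcoeff y) q0.
  by rewrite /q (mcoeff_bounded_sum (fun m => a (inr m))) mcoeff0.
have {GH}G0 : G = 0 by move: GH; rewrite HE q0 mulr0 addr0.
move=> [x|y]; last exact: a_inr.
have qx (y : 'X_{1..n < (kap * rho).+1}) : (mdeg (quo y) < (kap * rho).+1)%N.
  apply: leq_ltn_trans (bmdeg y); rewrite !mdegE; apply: leq_sum => i _.
  by rewrite mnmE leq_div.
pose bq y := BMultinom (qx y).
pose a' (m : 'X_{1..n}) t := \sum_(y : 'X_{1..n < (kap * rho).+1} |
  (quo y == m) && (rem y == t)) a (inl y).
have a'x : a' (quo x) (rem x) = a (inl x).
  rewrite /a' (big_pred1 x) // => y /=; apply/andP/eqP => [[/eqP qE /eqP rE]|-> //].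
  by apply/val_inj/remP.
rewrite -a'x.
apply: (@fpow_indep K n f K_big n_gt0 _ Z b fZ Z_all bZ a' (kap * rho).+1 _ (bq x)).
rewrite -[RHS]G0 /G [RHS](partition_big bq xpredT) //=; apply: eq_bigr => m _.
rewrite [RHS](partition_big (fun y => rem (bmnm y)) xpredT) //=.
apply: eq_bigr => t _; rewrite /a' scaler_suml; apply: eq_big => y.
  by rewrite -val_eqE.
by move=> /andP [/eqP <- /eqP <-].
Qed.

(** Both sides of [zero_at_infinity_bound] grow like [rho^n], but their difference
    is of order [rho^(n-1)] up to the term [N rho]. *)
Lemma top_forms_sop : sop [seq pihomog mdeg (k i) (f i) | i <- enum 'I_n].
Proof.
move=> v fv l; apply/eqP; apply: contraT => vl.
have {}fv i : (pihomog mdeg (k i) (f i)).@[v] = 0.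
  by apply/fv/(map_f (fun i => pihomog mdeg (k i) (f i))); rewrite mem_enum.
pose n' := n.-1; have nE : n = n'.+1 by rewrite prednK.
(* for [rho = n Q] the bound reads [Q^n <= C * Q^(n-1)], which fails for [Q > C];
   the terms [n + c] absorb the lower order terms *)
pose C := (c * (kap * n + 1) ^ n')%N; pose Q := (C + n + c).+1.
have := zero_at_infinity_bound (n * Q) vl fv.
rewrite /N !card_mnm // => bound.
have QC : (Q ^ n <= c * (kap * (n * Q) + n + c) ^ n')%N.
  rewrite -(leq_add2l 'C(kap * (n * Q) + n, n)).
  apply: (@leq_trans 'C(kap * (n * Q) + n + c, n)).
    rewrite addnAC [(_ + c)%N]addnC.
    by apply: leq_trans bound; rewrite leq_add2l card_mnm_ge.
  by have := bin_shift (kap * (n * Q) + n) c n'; rewrite -nE.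
have : (Q ^ n <= C * Q ^ n')%N.
  apply: leq_trans QC _; rewrite /C -mulnA -expnMn leq_mul2l; apply/orP; right.
  have le : (kap * (n * Q) + n + c <= (kap * n + 1) * Q)%N.
    by rewrite mulnDl mul1n mulnA -addnA leq_add2l /Q -addnA leqW ?leq_addl.
  by case: (n') => // j; rewrite leq_exp2r.
rewrite nE expnS leq_pmul2r; last by rewrite expn_gt0.
by rewrite /Q -addnA leqNgt ltnS leq_addr.
Qed.

End NoZeroAtInfinity.

(** * Ideals whose leading forms are regular *)

Section LeadingForms.
Variables (K : fieldType) (n : nat).
Local Notation A := {mpoly K[n]}.
Local Notation pih := (pihomog mdeg).
Implicit Types (p q g z : A) (fk : seq (A * nat)).

Lemma msizeP p d : (msize p <= d)%N <-> forall m, (d <= mdeg m)%N -> p@_m = 0.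
Proof.
split=> [pd m dm|h].
  by apply: memN_msupp_eq0; apply: msize_mdeg_ge; apply: leq_trans pd dm.
have [->|p0] := eqVneq p 0; first by rewrite msize0.
by rewrite -mlead_deg // ltnNge; apply/negP => /h/eqP; rewrite mleadc_eq0 (negPf p0).
Qed.

Lemma mcoeff_pihomog p d m : (pih d p)@_m = if mdeg m == d then p@_m else 0.
Proof.
rewrite (pihomogwE _ _ (leqnn (msize p))) raddf_sum /=.
have [ms|ms] := ltnP (mdeg m) (msize p); last first.
  rewrite (memN_msupp_eq0 (msize_mdeg_ge ms)) if_same.
  rewrite big1 // => m' _; rewrite mcoeffZ mcoeffX; case: eqVneq => [mE|].
    by have := bmdeg m'; rewrite mE ltnNge ms.
  by rewrite mulr0.
case: ifP => md; last first.
  rewrite big1 // => m' /eqP m'd; rewrite mcoeffZ mcoeffX.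
  case: eqVneq => [mE|]; last by rewrite mulr0.
  by rewrite -mE m'd eqxx in md.
rewrite (bigD1 (BMultinom ms)) //= mcoeffZ mcoeffX eqxx mulr1 big1 ?addr0 //.
move=> m' /andP [_ m'm]; rewrite mcoeffZ mcoeffX.
case: eqVneq => [mE|]; last by rewrite mulr0.
by case/eqP: m'm; apply: val_inj.
Qed.

Lemma pihomog_low p d : (msize p <= d)%N -> pih d p = 0.
Proof.
move=> /msizeP pd; apply/mpolyP => m; rewrite mcoeff_pihomog mcoeff0.
by case: eqVneq => // md; apply: pd; rewrite md.
Qed.

Lemma msize_sub_top p d : (msize p <= d.+1)%N -> (msize (p - pih d p) <= d)%N.
Proof.
move=> /msizeP pd; apply/msizeP => m dm; rewrite mcoeffB mcoeff_pihomog.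
case: eqVneq => [_|md]; first by rewrite subrr.
by rewrite pd ?subrr // ltn_neqAle eq_sym md.
Qed.

Lemma msizeD_bound d p q : (msize p <= d)%N -> (msize q <= d)%N ->
  (msize (p + q) <= d)%N.
Proof. by move=> pd qd; rewrite (leq_trans (msizeD_le _ _)) // geq_max pd. Qed.

Lemma msizeB_bound d p q : (msize p <= d)%N -> (msize q <= d)%N ->
  (msize (p - q) <= d)%N.
Proof. by move=> pd qd; apply: msizeD_bound; rewrite ?msizeN. Qed.

Lemma msizeM_lt d k z q : (msize z <= d)%N -> (msize q <= k.+1)%N ->
  (msize (z * q) <= d + k)%N.
Proof.
case: d => [|d] zd qk.
  by move: zd; rewrite leqn0 msize_poly_eq0 => /eqP ->; rewrite mul0r msize0.
exact: msizeM_bound.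
Qed.

Lemma pihomogM z q e k : (msize z <= e.+1)%N -> (msize q <= k.+1)%N ->
  pih (e + k) (z * q) = pih e z * pih k q.
Proof.
move=> ze qk; have -> : z * q = pih e z * pih k q + (z - pih e z) * q
    + pih e z * (q - pih k q) by ring.
have l1 : (msize ((z - pih e z) * q) <= e + k)%N.
  by apply: msizeM_lt => //; apply: msize_sub_top.
have l2 : (msize (pih e z * (q - pih k q)) <= e + k)%N.
  rewrite mulrC addnC; apply: msizeM_lt; first exact: msize_sub_top.
  exact/homog_msize_le/pihomogP.
rewrite !linearD /= (pihomog_low l1) (pihomog_low l2) !addr0 pihomog_dE //.
by apply: dhomogM; apply: pihomogP.
Qed.

Lemma msize_sub0 z d k : (d <= k)%N -> (msize z <= d - k)%N -> z = 0.
Proof. by rewrite -subn_eq0 => /eqP ->; rewrite leqn0 msize_poly_eq0 => /eqP. Qed.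

Definition tops fk : seq A := [seq pih a.2 a.1 | a <- fk].
Definition pols fk : seq A := [seq a.1 | a <- fk].
Definition degrees_ok fk :=
  forall a, a \in fk -> (0 < a.2)%N /\ (msize a.1 <= a.2.+1)%N.

Lemma degrees_ok_cons a fk : degrees_ok (a :: fk) ->
  [/\ (0 < a.2)%N, (msize a.1 <= a.2.+1)%N & degrees_ok fk].
Proof.
move=> ok; have [a0 ad] := ok a (mem_head _ _); split=> // b bfk.
by apply: ok; rewrite inE bfk orbT.
Qed.

Lemma hpos_tops fk : degrees_ok fk -> hpos (tops fk).
Proof.
move=> ok p /mapP [a /ok [a0 _] ->]; exists a.2 => //; exact: pihomogP.
Qed.

Lemma lift_top fk h e : degrees_ok fk -> h \is e.-homog -> gen (tops fk) h ->
  exists w, [/\ gen (pols fk) w, (msize w <= e.+1)%N & (msize (w - h) <= e)%N].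
Proof.
elim: fk h => [|a fk IH] h /=.
  by move=> _ _ ->; exists 0; rewrite subrr msize0.
move=> /degrees_ok_cons [a0 ad ok] hh Gh.
have gG := graded_gen (hpos_tops ok).
have [ae|ea] := leqP a.2 e; last first.
  case: Gh => z /(gG.2 _ e); rewrite linearB /= (pihomogM_homog0 _ (pihomogP _ _ _)) //.
  rewrite subr0 pihomog_dE // => /(IH _ ok hh) [w [Gw we wh]].
  by exists w; split=> //; apply: sub_isum.
have hh' : h \is (e - a.2 + a.2).-homog by rewrite subnK.
have [v hv Gv] := isum_homog gG (pihomogP _ _ _) hh' Gh.
have hr : h - v * pih a.2 a.1 \is e.-homog.
  apply: rpredB => //; rewrite -(subnK ae); apply: dhomogM => //; exact: pihomogP.
have [w [Gw we wh]] := IH _ ok hr Gv.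
have ve := homog_msize_le hv.
have va : (msize (v * a.1) <= e.+1)%N.
  by rewrite -(subnK ae) -addSn; apply: msizeM_lt.
exists (w + v * a.1); split; last 1 first.
- have -> : w + v * a.1 - h = (w - (h - v * pih a.2 a.1)) + v * (a.1 - pih a.2 a.1).
    by ring.
  apply: msizeD_bound => //; rewrite -(subnK ae) mulrC addnC.
  by apply: msizeM_lt => //; apply: msize_sub_top.
- by exists v; rewrite addrK.
- exact: msizeD_bound.
Qed.

(** Cancelling leading forms: a multiplier [z] of [a] whose degree is too high
    for [g] has its leading form in the ideal of the earlier leading forms, by
    regularity, and can be lowered by an element of the earlier ideal. *)
Lemma lower_multiplier a fk g d : degrees_ok (a :: fk) ->
    reg (tops (a :: fk)) ->
    (forall x e, gen (pols fk) x -> (msize x <= e.+1)%N ->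
       gen (tops fk) (pih e x)) ->
    gen (pols (a :: fk)) g -> (msize g <= d)%N ->
  exists2 z, (msize z <= d - a.2)%N & gen (pols fk) (g - z * a.1).
Proof.
move=> /degrees_ok_cons [a0 ad ok] [ra rl] top_fk [z Gz] gd.
have [s zs] : exists s, (msize z <= s)%N by exists (msize z).
elim: s z zs Gz => [|e IH] z ze Gz; first by exists z => //; apply: leq_trans ze _.
have [zd|dz] := leqP (msize z) (d - a.2); first by exists z.
have de : (d <= e + a.2)%N.
  by rewrite addnC -leq_subLR -ltnS (leq_trans dz).
have : gen (tops fk) (pih (e + a.2) (g - z * a.1)).
  apply: top_fk => //; apply: msizeB_bound; first by rewrite (leq_trans gd) // ltnW.
  by rewrite -addSn; apply: msizeM_lt.
rewrite linearB /= (pihomog_low (leq_trans gd de)) sub0r pihomogM //.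
move=> /(idealN (ideal_gen _)); rewrite opprK mulrC => /ra Gtz.
have [w [Gw we wz]] := lift_top ok (pihomogP _ _ _) Gtz.
apply: (IH (z - w)).
  have -> : z - w = (z - pih e z) - (w - pih e z) by ring.
  by apply: msizeB_bound => //; apply: msize_sub_top.
have -> : g - (z - w) * a.1 = (g - z * a.1) + w * a.1 by ring.
apply: (idealD (ideal_gen _)) => //; exact: (idealMr (ideal_gen _)).
Qed.

(** Once multipliers have the least possible degree, no cancellation occurs
    between leading forms. *)
Lemma top_of_gen fk : degrees_ok fk -> reg (tops fk) ->
  forall x e, gen (pols fk) x -> (msize x <= e.+1)%N -> gen (tops fk) (pih e x).
Proof.
elim: fk => [|a fk IH] ok rfk x e; first by move=> /= -> _; rewrite pihomog0.
have [a0 ad ok'] := degrees_ok_cons ok; have rfk' := rfk.2.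
move=> Gx xe; have [z ze Gz] := lower_multiplier ok rfk (IH ok' rfk') Gx xe.
have idG : ideal (gen (tops (a :: fk))) := ideal_gen _.
rewrite -(subrK (z * a.1) x) linearD /=; apply: (idealD idG).
  apply: sub_isum; apply: IH => //; apply: msizeB_bound => //.
  have [ae|ea] := leqP a.2 e.+1.
    by rewrite -(subnK ae); apply: msizeM_lt.
  by rewrite (msize_sub0 (ltnW ea) ze) mul0r msize0.
have [ae|ea] := leqP a.2 e.
  rewrite -{1}(subnK ae) pihomogM // -?subSn //.
  by apply: mem_isum; apply: ideal_gen.
rewrite (msize_sub0 ea ze) mul0r pihomog0.
exact: (ideal0 idG).
Qed.

Lemma bounded_multiplier a fk g d : degrees_ok (a :: fk) ->
    reg (tops (a :: fk)) -> gen (pols (a :: fk)) g -> (msize g <= d)%N ->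
  exists2 z, (msize z <= d - a.2)%N & gen (pols fk) (g - z * a.1).
Proof.
move=> ok rfk; apply: lower_multiplier => //.
by have [_ _ ok'] := degrees_ok_cons ok; apply: top_of_gen => //; case: rfk.
Qed.

(** If [a z] is in the ideal, so is the leading form of [z] on the level of
    leading forms; subtract a lift and induct on the degree of [z]. *)
Lemma nzd_pols a fk : degrees_ok (a :: fk) -> reg (tops (a :: fk)) ->
  nzd (gen (pols fk)) a.1.
Proof.
move=> ok rfk z; have [a0 ad ok'] := degrees_ok_cons ok; have [ra rl] := rfk.
have [s zs] : exists s, (msize z <= s)%N by exists (msize z).
have idG : ideal (gen (pols fk)) := ideal_gen _.
elim: s z zs => [|e IH] z ze Gz.
  by move: ze; rewrite leqn0 msize_poly_eq0 => /eqP ->; apply: ideal0.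
have : gen (tops fk) (pih (e + a.2) (a.1 * z)).
  by apply: top_of_gen => //; rewrite mulrC -addSn; apply: msizeM_lt.
rewrite mulrC pihomogM // mulrC => /ra Gtz.
have [w [Gw we wz]] := lift_top ok' (pihomogP _ _ _) Gtz.
rewrite -(subrK w z); apply: (idealD idG) => //; apply: IH.
  have -> : z - w = (z - pih e z) - (w - pih e z) by ring.
  by apply: msizeB_bound => //; apply: msize_sub_top.
by rewrite mulrBr; apply: (idealB idG) => //; apply: (idealM idG).
Qed.

End LeadingForms.

(** * The Hilbert function *)

Section HilbertFunction.
Variables (K : fieldType) (n : nat).
Local Notation A := {mpoly K[n]}.
Implicit Types (fk : seq (A * nat)).
Hypothesis n_gt0 : (0 < n)%N.

Definition below d (p : A) := (msize p <= d)%N.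

Lemma has_codim_unique (V : lmodType K) (W U : V -> Prop) r r' : subspace U ->
  has_codim W U r -> has_codim W U r' -> r = r'.
Proof.
have le r1 r2 : subspace U -> has_codim W U r1 -> has_codim W U r2 -> (r1 <= r2)%N.
  by move=> hU [s [<- si sW _]] h'; apply: (has_codim_bound hU h' si sW).
by move=> hU h h'; apply/eqP; rewrite eqn_leq !le.
Qed.

Lemma below_mul d k z a : (msize a <= k.+1)%N -> below (d - k) z -> below d (z * a).
Proof.
rewrite /below => ak; have [kd|dk] := leqP k d => zd.
  by rewrite -(subnK kd); apply: msizeM_lt.
by rewrite (msize_sub0 (ltnW dk) zd) mul0r msize0.
Qed.

Lemma below_comb d (c : nat -> K) s : (forall x, x \in s -> below d x) ->
  below d (comb c s).
Proof.
move=> sd; rewrite /comb; apply: (big_ind (below d)) => [|x y|i _].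
- by rewrite /below msize0.
- exact: msizeD_bound.
by apply: leq_trans (msizeZ_le _ _) _; apply: sd; apply: mem_nth.
Qed.

(** Multiplication by [a] embeds the second quotient into the first, and the
    cokernel is the quotient by [isum I a]. *)
Lemma codim_step (I : A -> Prop) (a : A) k d r r' : ideal I -> nzd I a ->
    (msize a <= k.+1)%N ->
    (forall g, isum I a g -> (msize g <= d)%N ->
       exists2 z, (msize z <= d - k)%N & I (g - z * a)) ->
    has_codim (below d) I r -> has_codim (below (d - k)) I r' ->
  (r' <= r)%N /\ has_codim (below d) (isum I a) (r - r').
Proof.
move=> idI Ia ak mult hr [s' [<- s'i s'W s'sp]].
have sI := ideal_subspace idI.
pose as' := [seq x * a | x <- s'].
have comb_as (c : nat -> K) : comb c as' = comb c s' * a :> A.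
  rewrite /comb size_map mulr_suml; apply: eq_bigr => i _.
  by rewrite (nth_map 0) // scalerAl.
have as_i : indep I as'.
  by move=> c; rewrite comb_as mulrC => /Ia /s'i h i; rewrite size_map => /h.
have as_W x : x \in as' -> below d x.
  by move=> /mapP [y /s'W yd ->]; apply: (below_mul ak).
have [t [ti tW tsp]] := extend_basis sI (has_codim_bound sI hr) as_i as_W.
have rE : r = (size t + size s')%N.
  apply: (has_codim_unique sI hr); exists (t ++ as'); split=> //.
  by rewrite size_cat size_map.
rewrite rE leq_addl addnK; split=> //; exists t; split=> // [c Ic|x xt|x xd].
- have td : below d (comb c t).
    by apply: below_comb => x xt; apply: tW; rewrite mem_cat xt.
  have [z zd Iz] := mult _ Ic td.
  have [c' Ic'] := s'sp z zd.
  pose c2 i := if (i < size t)%N then c i else - c' (i - size t)%N.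
  have := ti c2; rewrite comb_cat.
  rewrite (@eq_comb _ _ c2 c t); last by move=> i it; rewrite /c2 it.
  rewrite (@eq_comb _ _ _ (fun i => - c' i) as'); last first.
    by move=> i _; rewrite /c2 ltnNge leq_addr /= addKn.
  have -> : comb (fun i => - c' i) as' = - (comb c' s' * a).
    rewrite -comb_as /comb -sumrN; apply: eq_bigr => i _; exact: scaleNr.
  have Icc : I (comb c t - comb c' s' * a).
    have -> : comb c t - comb c' s' * a =
      (comb c t - z * a) + (z - comb c' s') * a by ring.
    by apply: idealD => //; apply: idealMr.
  move=> /(_ Icc) h i it; have := h i; rewrite /c2 it size_cat; apply.
  by rewrite (leq_trans it) // leq_addr.
- by apply: tW; rewrite mem_cat xt.
have [c Ic] := tsp x xd; exists c.
exists (comb (fun i => c (size t + i)%N) s').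
by move: Ic; rewrite comb_cat comb_as opprD addrA.
Qed.

(** Equal to [e_along] up to the order of the degrees, but recursive on the last
    equation. *)
Definition hilbert (ks : seq nat) : int -> int := foldr nabla (e_num n) ks.

Lemma hilbert_neg ks m : m < 0 -> hilbert ks m = 0.
Proof.
elim: ks m => [|k ks IH] m m0 /=; first by case: m m0.
by rewrite /nabla IH // IH ?subrr //; lia.
Qed.

(** Polynomials of size at most [d] have degree at most [d - 1], hence the
    argument; for [d = 0] both sides are zero. *)
Lemma codim_gen fk d : degrees_ok fk -> reg (tops fk) ->
  exists2 r, has_codim (below d) (gen (pols fk)) r &
    r%:Z = hilbert [seq a.2 | a <- fk] (d%:Z - 1).
Proof.
elim: fk d => [|a fk IH] d.
  move=> _ _ /=; exists #|{: 'X_{1..n < d}}|.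
    exists [seq 'X_[bmnm m] | m <- enum {: 'X_{1..n < d}}]; split.
    - by rewrite size_map -cardE.
    - apply: indep_fam => c c0 m.
      by rewrite -(mcoeff_bounded_sum c m) c0 mcoeff0.
    - by move=> x /mapP [m _ ->]; rewrite /below msizeX bmdeg.
    - move=> x xd; apply: (inspan_fam (c := fun m : 'X_{1..n < d} => x@_m)).
      by rewrite -mpolywE ?subrr.
  rewrite /hilbert /=; case: d => [|d]; first by rewrite eq_card0 // => -[].
  by rewrite card_mnm // -addn1 PoszD addrK.
move=> ok rfk; have [a0 ad ok'] := degrees_ok_cons ok; have rfk' := rfk.2.
have [r hr rE] := IH d ok' rfk'; have [r' hr' rE'] := IH (d - a.2)%N ok' rfk'.
have [r'r h] := codim_step (ideal_gen _) (nzd_pols ok rfk) ad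
  (fun g Gg gd => bounded_multiplier ok rfk Gg gd) hr hr'.
exists (r - r')%N => //=; rewrite /nabla -/(hilbert _) -rE -subzn //; congr (_ - _).
rewrite rE'; have [kd|dk] := leqP a.2 d; first by rewrite -subzn // addrAC.
by rewrite !hilbert_neg //; lia.
Qed.

End HilbertFunction.

(** * Radical ideals *)

Section RadicalIdeals.
Variables (K : closedFieldType) (n : nat).
Local Notation A := {mpoly K[n]}.
Hypothesis K_big : big_fibres K.
Implicit Types (fk : seq (A * nat)) (l : seq A).

Definition vanishes l (g : A) :=
  forall z : 'I_n -> K, (forall p, p \in l -> p.@[z] = 0) -> g.@[z] = 0.

Definition radical l := forall g, vanishes l g -> gen l g.

(** A power of [z * a] is in the ideal, hence a power of [z] is. *)
Lemma vanishes_nzd l a z : nzd (gen l) a -> vanishes l (z * a) -> vanishes l z.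
Proof.
move=> ra za x xl.
have [j] : exists j, gen l ((z * a) ^+ j).
  apply: (nullstellensatz K_big) => [|y yl]; first exact: ideal_gen.
  by apply: za => p pl; apply/yl/mem_gen.
rewrite mulrC exprMn => /(nzdX ra) Gz; have := gen_eval0 xl Gz.
by rewrite rmorphXn /= => /eqP; rewrite expf_eq0 => /andP [_ /eqP].
Qed.

(** Dropping the last equation keeps the ideal radical: a multiple [z * a] of it
    that vanishes on the larger zero set has a factor [z] of smaller degree that
    vanishes there too. *)
Lemma radical_tail a fk : degrees_ok (a :: fk) -> reg (tops (a :: fk)) ->
  radical (pols (a :: fk)) -> radical (pols fk).
Proof.
move=> ok rfk rad g; have [a0 ad ok'] := degrees_ok_cons ok.
have [s] : exists s, (msize g <= s)%N by exists (msize g).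
elim: s g => [|s IH] g gs gv.
  move: gs; rewrite leqn0 msize_poly_eq0 => /eqP ->.
  by apply: ideal0; apply: ideal_gen.
have Gg : gen (pols (a :: fk)) g.
  by apply: rad => z zl; apply: gv => p pl; apply: zl; rewrite inE pl orbT.
have [z zd Gz] := bounded_multiplier ok rfk Gg gs.
apply: (ideal_congr (ideal_gen _) Gz); apply: (idealMr (ideal_gen _)).
apply: IH; first by rewrite (leq_trans zd) // leq_subLR -add1n leq_add2r.
apply: (vanishes_nzd (nzd_pols ok rfk)) => x xl.
have := gen_eval0 xl Gz; rewrite mevalB gv // sub0r => /eqP.
by rewrite oppr_eq0 => /eqP.
Qed.

Lemma radical_suffix fk fk' : degrees_ok (fk ++ fk') -> reg (tops (fk ++ fk')) ->
  radical (pols (fk ++ fk')) -> radical (pols fk').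
Proof.
elim: fk => // a fk IH /= ok rfk rad.
have [_ _ ok'] := degrees_ok_cons ok.
by apply: IH => //; [case: rfk | apply: radical_tail rad].
Qed.

Lemma reg_suffix fk fk' : reg (tops (fk ++ fk')) -> reg (tops fk').
Proof. by elim: fk => // a fk IH [_ /IH]. Qed.

Section CompleteIntersection.
Hypothesis n_gt0 : (0 < n)%N.
Variables (fk : seq (A * nat)) (D : nat) (Z : 'I_D -> 'I_n -> K).
Hypothesis size_fk : size fk = n.
Hypothesis fk_ok : degrees_ok fk.
Hypothesis D_eq : D = (\prod_(a <- fk) a.2)%N.
Hypothesis Z_inj : forall t t', Z t =1 Z t' -> t = t'.
Hypothesis Z_zero : forall t p, p \in pols fk -> p.@[Z t] = 0.
Hypothesis Z_all :
  forall z, (forall p, p \in pols fk -> p.@[z] = 0) -> exists t, z =1 Z t.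

(** Products of linear polynomials, each in a coordinate that separates the two
    points. *)
Lemma interpolating_basis :
  exists b : 'I_D -> A, forall t t', (b t).@[Z t'] = (t == t')%:R.
Proof.
have /choice [l hl] : forall tt : 'I_D * 'I_D, exists l : 'I_n,
    tt.1 != tt.2 -> Z tt.1 l != Z tt.2 l.
  move=> [t t'] /=; have [->|tt'] := eqVneq t t'.
    by exists (Ordinal n_gt0).
  have [l Zl] : exists l : 'I_n, Z t l <> Z t' l.
    apply: contrapT => /forallNP h; case/eqP: tt'; apply: Z_inj => l.
    by apply: contrapT; apply: h.
  by exists l => _; apply/eqP.
exists (fun t => \prod_(t' | t' != t) ((Z t (l (t, t')) - Z t' (l (t, t')))^-1
  *: ('X_(l (t, t')) - (Z t' (l (t, t')))%:MP))) => t t'.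
rewrite rmorph_prod /=; case: eqVneq => [<-|tt'].
  rewrite big1 // => t1 t1t; rewrite mevalZ mevalB mevalXU mevalC mulVf //.
  by rewrite subr_eq0; apply: (hl (t, t1)); rewrite eq_sym.
rewrite (bigD1 t') 1?eq_sym //= mevalZ mevalB mevalXU mevalC subrr mulr0.
by rewrite mul0r.
Qed.

Let f (i : 'I_n) := (nth (0, 0%N) fk i).1.
Let k (i : 'I_n) := (nth (0, 0%N) fk i).2.

Let mem_nth_fk (i : 'I_n) : nth (0, 0%N) fk i \in fk.
Proof. by rewrite mem_nth // size_fk. Qed.

Let fkE : fk = [seq (f i, k i) | i <- enum 'I_n].
Proof.
apply: (@eq_from_nth _ (0, 0%N)); first by rewrite size_map size_enum_ord.
move=> i; rewrite size_fk => ilt.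
rewrite (nth_map (Ordinal ilt)) ?size_enum_ord // /f /k nth_enum_ord //.
by case: (nth _ _ _).
Qed.

Lemma complete_intersection_regular : reg (tops fk).
Proof.
have [b hb] := interpolating_basis.
apply: (sop_regular K_big); first by rewrite size_map.
  exact: hpos_tops.
have -> : tops fk = [seq pihomog mdeg (k i) (f i) | i <- enum 'I_n].
  by rewrite /tops fkE -map_comp.
apply: (top_forms_sop (D := D) (Z := Z) (b := b) K_big n_gt0) => //.
- by move=> i; case: (fk_ok (mem_nth_fk i)).
- by move=> i; case: (fk_ok (mem_nth_fk i)).
- by move=> i t; apply: Z_zero; apply: map_f.
- move=> z fz; apply: Z_all => p /mapP [a]; rewrite fkE => /mapP [i _ ->] ->.
  exact: fz.
- by rewrite D_eq fkE big_map big_enum.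
Qed.

Hypothesis hilbert_le : forall m : int,
  hilbert n [seq a.2 | a <- fk] m <= D%:Z.

(** In large degree, vanishing at the [D] zeros amounts to [D] independent
    conditions, while the ideal has codimension at most [D]. *)
Lemma complete_intersection_radical : radical (pols fk).
Proof.
have rfk := complete_intersection_regular.
have [b hb] := interpolating_basis.
move=> g gv; apply: contrapT => Gg.
have gZ t : g.@[Z t] = 0 by apply: gv => p; apply: Z_zero.
pose d := maxn (msize g) (\max_t msize (b t)).
have [r hr rE] := codim_gen n_gt0 d fk_ok rfk.
have sG := ideal_subspace (ideal_gen (pols fk)).
pose bs := [seq b t | t <- enum 'I_D].
have GZ x t : gen (pols fk) x -> x.@[Z t] = 0.
  by apply: gen_eval0 => p; apply: Z_zero.
have bZ c t : (\sum_t' c t' *: b t').@[Z t] = c t.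
  rewrite raddf_sum (bigD1 t) //= mevalZ hb eqxx mulr1 big1 ?addr0 // => t' t't.
  by rewrite mevalZ hb (negPf t't) mulr0.
have bi : indep (gen (pols fk)) bs.
  by apply: indep_fam => c Gc t; rewrite -(bZ c) GZ.
have gi : indep (gen (pols fk)) (g :: bs).
  apply: (indep_cons sG) => // -[c Gc]; apply: Gg.
  suff c0 : comb c bs = 0 by move: Gc; rewrite c0 subr0.
  pose c' (t : 'I_D) := c (enum_rank t).
  have cE : comb c bs = \sum_t c' t *: b t by apply: comb_fam.
  rewrite cE big1 // => t _; suff -> : c' t = 0 by rewrite scale0r.
  have := GZ _ t Gc; rewrite cE mevalB bZ gZ sub0r => /eqP.
  by rewrite oppr_eq0 => /eqP.
have := has_codim_bound sG hr gi.
have sz : size (g :: bs) = D.+1 by rewrite /= size_map -cardE card_ord.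
rewrite sz => h.
have : (D < r)%N.
  apply: h => x; rewrite inE => /orP [/eqP ->|/mapP [t _ ->]].
    by rewrite /below leq_maxl.
  by rewrite /below leq_max (leq_bigmax t) orbT.
have := hilbert_le (d%:Z - 1); rewrite -rE lez_nat => rD.
by rewrite ltnNge rD.
Qed.

End CompleteIntersection.

End RadicalIdeals.

(** * Separation by points *)

Section Nodes.
Variables (K : fieldType) (n : nat).
Local Notation A := {mpoly K[n]}.

(** The evaluation vectors of the points of [S] span [K^r], since a linear form
    that kills them all is a combination of the functions that vanishes on [S];
    points whose vectors form a basis are the required ones. *)
Lemma separating_points (r : nat) (s : 'I_r -> A) (S : ('I_n -> K) -> Prop) :
    (forall c : 'I_r -> K, (forall z, S z -> (\sum_i c i *: s i).@[z] = 0) ->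
       forall i, c i = 0) ->
  exists2 Q : 'I_r -> 'I_n -> K, forall i, S (Q i) &
    forall q : 'I_r -> K, exists c : 'I_r -> K,
      forall i, (\sum_j c j *: s j).@[Q i] = q i.
Proof.
move=> s_ind.
pose ev z : 'rV[K]_r := \row_j (s j).@[z].
have [| | |t [ti tS tsp]] := @extend_basis _ _ _ (subspace0 'rV[K]_r)
    (fun x => exists2 z, S z & x = ev z) r [::].
- move=> t ti _; rewrite -(card_ord (size t)) -[X in (_ <= X)%N](card_ord r).
  apply: (steinitz (subspace0 _) (v := fun i : 'I_(size t) => t`_i)
     (w := fun j : 'I_r => delta_mx 0 j)) => [c c0 i|i].
    pose c' k := if insub k is Some i then c i else 0.
    have cE (j : 'I_(size t)) : c' j = c j by rewrite /c' valK.
    rewrite -cE; apply: (ti c') => //; rewrite /comb.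
    by under eq_bigr do rewrite cE.
  by exists (fun j => t`_i 0 j); apply/eqP; rewrite subr_eq0 -row_sum_delta.
- by [].
- by [].
rewrite cats0 in ti tS tsp.
pose T := \matrix_(i < size t) t`_i.
have tr : (r <= size t)%N.
  rewrite leqNgt; apply/negP => tr.
  have : kermx T^T != 0.
    rewrite -mxrank_eq0 mxrank_ker -lt0n subn_gt0.
    exact: leq_ltn_trans (rank_leq_col _) tr.
  case/matrix0Pn => a [j0]; set kj := kermx _ _ _ => kj0.
  have Tk (i : 'I_(size t)) : \sum_j kermx T^T a j * t`_i 0 j = 0.
    have /matrixP/(_ a i) := mulmx_ker T^T; rewrite mxE [RHS]mxE => kT.
    by rewrite -[RHS]kT; apply: eq_bigr => j _; rewrite [T^T _ _]mxE [T _ _]mxE.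
  have /s_ind/(_ j0) : forall z, S z ->
      (\sum_j kermx T^T a j *: s j).@[z] = 0.
    move=> z Sz; have [|c] := tsp (ev z); first by exists z.
    move/eqP; rewrite subr_eq0 => /eqP evE.
    have evj j : (s j).@[z] = \sum_(i < size t) c i * t`_i 0 j.
      have := congr1 (fun x : 'rV_r => x 0 j) evE; rewrite mxE summxE => ->.
      by apply: eq_bigr => i _; rewrite mxE.
    rewrite raddf_sum /=.
    under eq_bigr do rewrite mevalZ evj mulr_sumr.
    rewrite exchange_big big1 //= => i _.
    under eq_bigr do rewrite mulrCA.
    by rewrite -mulr_sumr Tk mulr0.
  by rewrite -/kj => kj00; rewrite kj00 eqxx in kj0.
have T_free : row_free T.
  rewrite -kermx_eq0; apply/eqP/matrixP => a j; rewrite [RHS]mxE.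
  pose c i := if insub i is Some i then kermx T a i else 0.
  have cE (i : 'I_(size t)) : c i = kermx T a i by rewrite /c valK.
  rewrite -cE; apply: (ti c) => //; rewrite /comb.
  have := congr1 (row a) (mulmx_ker T); rewrite row_mul row0 mulmx_sum_row => kT.
  rewrite -[RHS]kT; apply: eq_bigr => i _.
  by rewrite cE rowK; congr (_ *: _); rewrite [RHS]mxE.
have /choice [Q hQ] : forall i : 'I_r, exists z, S z /\ t`_i = ev z.
  move=> i; have [|z Sz ->] := tS t`_i; last by exists z.
  by rewrite mem_nth // (leq_trans (ltn_ord i)).
exists Q => [i|q]; first by case: (hQ i).
pose qv : 'cV[K]_(size t) := \col_i (if insub (val i) is Some j then q j else 0).
pose cv := pinvmx T *m qv.
have Tcv : T *m cv = qv by rewrite mulmxA mulmxVp // mul1mx.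
exists (fun j => cv j 0) => i; rewrite raddf_sum /=.
have /matrixP/(_ (widen_ord tr i) 0) := Tcv; rewrite mxE [RHS]mxE /= valK => <-.
apply: eq_bigr => j _; rewrite mevalZ mulrC [T _ _]mxE /= (hQ i).2.
by congr (_ * _); rewrite mxE.
Qed.

End Nodes.

(** * Difference operators and generating series *)

Section Differences.

Lemma nabla_ext k u v : u =1 v -> nabla k u =1 nabla k v.
Proof. by move=> uv m; rewrite /nabla !uv. Qed.

Lemma nablaC j k u : nabla j (nabla k u) =1 nabla k (nabla j u).
Proof.
move=> m; rewrite /nabla.
have -> : m - j%:Z - k%:Z = m - k%:Z - j%:Z by ring.
by ring.
Qed.

Lemma foldr_nabla_ext ks u v : u =1 v -> foldr nabla u ks =1 foldr nabla v ks.
Proof. by elim: ks => //= k ks IH uv; apply/nabla_ext/IH. Qed.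

Lemma foldr_nablaC j ks u :
  nabla j (foldr nabla u ks) =1 foldr nabla (nabla j u) ks.
Proof.
elim: ks => //= k ks IH m; rewrite nablaC; exact: nabla_ext.
Qed.

Lemma nabla_sum k u m : nabla k u m = \sum_(i < k) nabla 1 u (m - i%:Z).
Proof.
elim: k => [|k IH]; first by rewrite big_ord0 /nabla subr0 subrr.
by rewrite big_ord_recr /= -IH /nabla -addn1 PoszD opprD addrA; ring.
Qed.

Lemma nabla1_e_num n m : nabla 1 (e_num n.+1) m = e_num n m.
Proof.
case: m => [[|a]|a]; rewrite /nabla.
- by rewrite /= !add0n !binn subr0.
- have -> : a.+1%:Z - 1%:Z = a%:Z by lia.
  by rewrite /= addSnnS addnS binS PoszD addrAC subrr add0r addSnnS.
- have -> : Negz a - 1%:Z = Negz a.+1 by lia.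
  by rewrite /= subr0.
Qed.

Lemma e_num0 m : 0 <= e_num 0 m <= 1.
Proof. by case: m => a //=; rewrite bin0. Qed.

(** Each [nabla k] is a sum of [k] translates of [nabla 1], and [n] operators
    [nabla 1] turn [e_num n] into the indicator function of the nonnegative
    integers. *)
Lemma hilbert_bound n ks m : size ks = n ->
  hilbert n ks m <= (\prod_(k <- ks) k)%N%:Z.
Proof.
rewrite /hilbert => <-; elim: ks m => [|k ks IH] m /=.
  by rewrite big_nil; have /andP [] := e_num0 m.
rewrite big_cons PoszM nabla_sum.
apply: (@le_trans _ _ (\sum_(i < k) (\prod_(k <- ks) k)%N%:Z)).
  apply: ler_sum => i _; rewrite foldr_nablaC.
  by rewrite (foldr_nabla_ext _ (nabla1_e_num (size ks))).
by rewrite sumr_const card_ord -mulr_natl natz.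
Qed.

Lemma e_along_rev n (ks : seq nat) m : e_along n ks m = hilbert n (rev ks) m.
Proof. by rewrite /e_along /hilbert -foldl_rev revK. Qed.

(** Partial sums of the coefficients of [p * (1 - t)^(-n)], extended by zero so
    that multiplication of [p] by [1 - t^d] becomes [nabla d]. *)
Let psum (p : {poly int}) (n : nat) (m : int) : int :=
  if m is Posz a then
    \sum_(j < a.+1) series_mul (poly_series p) (iter n (series_mul geometric) series_one) j
  else 0.

Let geom n := iter n (series_mul geometric) series_one.

Lemma series_mul_geometric b j : series_mul geometric b j = \sum_(i < j.+1) b i.
Proof.
rewrite /series_mul [RHS](reindex_inj rev_ord_inj) /=; apply: eq_bigr => i _.
by rewrite mul1r subSS.
Qed.

Lemma geom_step n j : geom n.+1 j = \sum_(i < j.+1) geom n i.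
Proof. exact: series_mul_geometric. Qed.

Lemma geomS n j : geom n.+1 j = 'C(j + n, n)%:Z.
Proof.
elim: n j => [|n IH] j; rewrite geom_step.
  by rewrite big_ord_recl big1 // addr0 bin0.
elim: j => [|j IHj].
  by rewrite big_ord1 IH /= !add0n !binn.
by rewrite big_ord_recr IHj IH [(j.+1 + n.+1)%N]addnS binS addSnnS PoszD.
Qed.

Lemma psum1 n m : psum 1 n m = e_num n m.
Proof.
case: m => //= a; rewrite -(geomS n a) geom_step.
apply: eq_bigr => j _; rewrite /series_mul big_ord_recl /poly_series coef1 mul1r subn0.
by rewrite big1 ?addr0 // => i _; rewrite coef1 mul0r.
Qed.

Lemma psum_mul p n d m : psum ((1 - 'X^d) * p) n m = nabla d (psum p n) m.
Proof.
have series_shift b j : series_mul (poly_series ('X^d * p)) b j =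
    if (j < d)%N then 0 else series_mul (poly_series p) b (j - d)%N.
  rewrite /series_mul /poly_series; have [jd|dj] := ltnP j d.
    rewrite big1 // => i _; rewrite coefXnM (leq_ltn_trans _ jd) ?mul0r //.
    by rewrite -ltnS.
  rewrite -(big_mkord xpredT (fun i => ('X^d * p)`_i * b (j - i)%N)).
  rewrite (big_cat_nat (n := d)) //= ?(leqW dj) // big_nat big1 ?add0r.
    rewrite -{1}[d]add0n big_addn subSn // big_mkord; apply: eq_bigr => i _.
    by rewrite coefXnM ltnNge leq_addl /= addnK subnDAC.
  by move=> i /andP [_ id]; rewrite coefXnM id mul0r.
have series_sub b j : series_mul (poly_series ((1 - 'X^d) * p)) b j =
    series_mul (poly_series p) b j - series_mul (poly_series ('X^d * p)) b j.
  rewrite /series_mul /poly_series -sumrB; apply: eq_bigr => i _.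
  by rewrite mulrBl mul1r coefB mulrBl.
rewrite /nabla; case: m => [a|a]; last first.
  by have -> : Negz a - d%:Z = Negz (a + d) by lia.
rewrite {1 2}/psum; under eq_bigr do rewrite series_sub.
rewrite sumrB; congr (_ - _); under eq_bigr do rewrite series_shift.
have [ad|da] := ltnP a d.
  have -> : a%:Z - d%:Z = Negz (d - a).-1 by lia.
  by rewrite /= big1 // => i _; rewrite (leq_trans (ltn_ord i)).
have -> : a%:Z - d%:Z = (a - d)%N%:Z by lia.
rewrite /psum; set S := series_mul _ _.
rewrite -(big_mkord xpredT (fun j => if (j < d)%N then 0 else S (j - d)%N)).
rewrite (big_cat_nat (n := d)) //= ?(leqW da) // big_nat big1 ?add0r.
  rewrite -{1}[d]add0n big_addn subSn // big_mkord; apply: eq_bigr => i _.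
  by rewrite ltnNge leq_addl /= addnK.
by move=> i /andP [_ id]; rewrite id.
Qed.

Lemma e_along_series n (ks : seq nat) (m : nat) :
  e_along n ks m%:Z = \sum_(j < m.+1) h_coef n ks j.
Proof.
have -> : \sum_(j < m.+1) h_coef n ks j = psum (\prod_(d <- rev ks) (1 - 'X^d)) n m%:Z.
  rewrite /psum /h_coef; apply: eq_bigr => j _; congr (series_mul (poly_series _) _ _).
  by rewrite (perm_big (rev ks)) // perm_sym perm_rev.
rewrite e_along_rev; elim: (rev ks) {m}(m%:Z) => [|d s IH] m /=.
  by rewrite big_nil psum1.
by rewrite big_cons psum_mul; apply/nabla_ext => x; rewrite IH.
Qed.

End Differences.

(** * Uncountability of the complex numbers *)

Section Uncountability.
Local Open Scope classical_set_scope.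

(** The unit interval does not have Lebesgue measure zero. *)
Lemma real_uncountable (R : realType) : ~ countable [set: R].
Proof.
move=> cR; pose I : set R := [set` `[(0 : R), 1]%R].
have cI : countable I by apply: sub_countable cR; apply/subset_card_le/subsetT.
have := etrans (esym (lebesgue_measure.countable_lebesgue_measure0 cI))
  (lebesgue_measure.lebesgue_measure_itv `[(0 : R), 1]%R).
rewrite /= constructive_ereal.lte_fin ltr01 => /esym [/eqP].
by rewrite subr0 oner_eq0.
Qed.

(** If all fibres of a map to the natural numbers had bounded size, the reals
    would be a countable union of finite sets. *)
Lemma complex_big_fibres (R : realType) : big_fibres R[i].
Proof.
move=> phi; apply: contrapT => /forallNP h.
apply: (@real_uncountable R).
have -> : [set: R] = \bigcup_m [set x : R | phi (x%:C)%C = m].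
  by apply/seteqP; split=> x // _; exists (phi (x%:C)%C).
apply: bigcup_countable => // m _; apply: finite_set_countable.
apply: contrapT => inf; apply: (h m) => N.
suff [s [us ss sm]] : exists s : seq R,
    [/\ uniq s, size s = N & forall x, x \in s -> phi (x%:C)%C = m].
  exists [seq (x%:C)%C | x <- s]; split; last by move=> y /mapP [x /sm xm ->].
    by rewrite map_inj_uniq // => x y [].
  by rewrite size_map.
elim: N => [|N [s [us ss sm]]]; first by exists [::].
have [x [xm xs]] : exists x, phi (x%:C)%C = m /\ x \notin s.
  apply: contrapT => nox; apply: inf; apply: sub_finite_set (finite_seq s) => x xm.
  by apply: contrapT => /negP xs; apply: nox; exists x.
exists (x :: s); rewrite /= xs us ss; split=> // y.
by rewrite inE => /orP [/eqP ->|/sm].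
Qed.

End Uncountability.

(** * Existence of nodes *)

Section Assembly.
Variables (R : realType) (n : nat).
Local Notation A := {mpoly R[i][n]}.

Lemma degrees_ok_zip s (f : s.-tuple A) (k : s.-tuple nat) :
  (forall i, hypersurface_of_degree (tnth f i) (tnth k i)) ->
  degrees_ok (zip f k).
Proof.
move=> f_deg a /(nthP (0 : A, 0%N)) [j].
rewrite size_zip !size_tuple minnn => si <-.
rewrite nth_zip ?size_tuple //=; have [k0 fk] := f_deg (Ordinal si).
by rewrite !(tnth_nth 0) /= in fk; rewrite (tnth_nth 0%N) /= in k0 fk; rewrite fk.
Qed.

Lemma pols_zip s (f : s.-tuple A) (k : s.-tuple nat) : pols (zip f k) = f.
Proof. by rewrite /pols -[map _ _]/(unzip1 _) unzip1_zip // !size_tuple. Qed.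

Lemma degrees_zip s (f : s.-tuple A) (k : s.-tuple nat) :
  [seq a.2 | a <- zip f k] = k.
Proof. by rewrite -[map _ _]/(unzip2 _) unzip2_zip // !size_tuple. Qed.

(** The added equations come first in the list, so that dropping them leaves the
    given ones. *)
Lemma sufficiently_intersect_radical s (f : s.-tuple A) (k : s.-tuple nat) :
    (0 < n)%N -> (s <= n)%N ->
    (forall i, hypersurface_of_degree (tnth f i) (tnth k i)) ->
    sufficiently_intersect f k ->
  [/\ degrees_ok (rev (zip f k)), reg (tops (rev (zip f k))) &
      radical (pols (rev (zip f k)))].
Proof.
move=> n_gt0 s_le_n f_deg [g [l [g_deg]]].
move=> /card_set_bijP [h [h_fun h_inj h_surj]].
set D := (\prod_(d <- k ++ l) d)%N in h_fun h_inj h_surj.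
pose fk := rev (zip g l) ++ rev (zip f k).
have size_fk : size fk = n.
  by rewrite /fk size_cat !size_rev !size_zip !size_tuple !minnn subnK.
have fk_ok : degrees_ok fk.
  move=> a; rewrite mem_cat !mem_rev => /orP [].
    exact: degrees_ok_zip g_deg a.
  exact: degrees_ok_zip f_deg a.
have polsE p : (p \in pols fk) = (p \in (f : seq A) ++ g).
  by rewrite /pols /fk map_cat !map_rev -!/(pols _) !pols_zip !mem_cat !mem_rev orbC.
have /choice [x hx] : forall t : 'I_D, exists x, common_zeros (f ++ g) x /\ h x = t.
  by move=> t; have [|x xS xt] := h_surj t; [exact: ltn_ord | exists x].
pose Z (t : 'I_D) (i : 'I_n) : R[i] := x t ord0 i.
have fk_int : reg (tops fk) /\ radical (pols fk).
  have DE : D = (\prod_(a <- fk) a.2)%N.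
    rewrite -(big_map snd xpredT id) /fk map_cat !map_rev !degrees_zip.
    rewrite /D !big_cat /= mulnC; congr (_ * _)%N.
      by apply: perm_big; rewrite perm_sym perm_rev.
    by apply: perm_big; rewrite perm_sym perm_rev.
  have Zinj t t' : Z t =1 Z t' -> t = t'.
    move=> Ztt'; apply/val_inj; rewrite /= -(hx t).2 -(hx t').2; congr (h _).
    by apply/matrixP => i j; rewrite !ord1; apply: Ztt'.
  have Z0 t p : p \in pols fk -> p.@[Z t] = 0.
    by rewrite polsE => /(hx t).1.
  have Zall z : (forall p, p \in pols fk -> p.@[z] = 0) -> exists t, z =1 Z t.
    move=> zp; pose y : 'rV[R[i]]_n := \row_i z i.
    have yS : common_zeros (f ++ g) y.
      move=> p pf; rewrite (meval_eq (v2 := z)); last by move=> i; rewrite mxE.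
      by apply: zp; rewrite polsE.
    exists (Ordinal (h_fun _ yS)) => i.
    rewrite /Z (h_inj (x _) y); first by rewrite mxE.
    - by rewrite inE; case: (hx (Ordinal (h_fun _ yS))).
    - by rewrite inE.
    by rewrite (hx _).2.
  have K_big := @complex_big_fibres R.
  split.
    exact: (complete_intersection_regular K_big n_gt0 size_fk fk_ok DE Zinj Z0 Zall).
  apply: (complete_intersection_radical K_big n_gt0 size_fk fk_ok DE Zinj Z0 Zall).
  move=> m; rewrite DE -(big_map snd xpredT id); apply: hilbert_bound.
  by rewrite size_map.
have [rfk radfk] := fk_int; split.
- by move=> a afk; apply: fk_ok; rewrite mem_cat afk orbT.
- exact: reg_suffix rfk.
- exact: (radical_suffix (@complex_big_fibres R) fk_ok rfk radfk).
Qed.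

End Assembly.

Theorem theorem3p4 (R : realType) (n s : nat) (s_gt0 : (1 <= s)%N)
  (s_le_n : (s <= n)%N) (f : s.-tuple {mpoly R[i][n]}) (k : s.-tuple nat)
  (f_deg : forall i : 'I_s, hypersurface_of_degree (tnth f i) (tnth k i))
  (f_sqf : forall i : 'I_s, without_multiple_factors (tnth f i))
  (f_int : sufficiently_intersect f k) (m : nat) :
  (exists (N : nat) (Q : 'I_N -> 'rV[R[i]]_n), PPSN f k m Q) /\
  e_along n k m%:Z = \sum_(j < m.+1) h_coef n k j.
Proof.
split; last exact: e_along_series.
have n_gt0 : (0 < n)%N by apply: leq_trans s_gt0 s_le_n.
have [ok rfk rad] := sufficiently_intersect_radical n_gt0 s_le_n f_deg f_int.
have [r [b [br bi bW bsp]] rE] := codim_gen n_gt0 m.+1 ok rfk.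
have polsE p : (p \in pols (rev (zip f k))) = (p \in f).
  by rewrite /pols map_rev -/(pols _) pols_zip mem_rev.
(* a basis of the polynomials of degree at most [m] modulo the ideal stays
   independent on the zero set, because the ideal is radical *)
have [c c0|Q0 Q0S Q0int] := @separating_points R[i] n r (fun i => b`_i)
    (fun z => forall p, p \in f -> p.@[z] = 0).
  have Gc : gen (pols (rev (zip f k))) (\sum_(i < r) c i *: b`_i).
    by apply: rad => z zp; apply: c0 => p pf; apply: zp; rewrite polsE.
  pose c' j := if insub j is Some i then c i else 0.
  have cE (j : 'I_r) : c' j = c j by rewrite /c' valK.
  move=> i; rewrite -cE; apply: (bi c'); last by rewrite br.
  by rewrite /comb br; under eq_bigr do rewrite cE.
have QE i p : p.@[(\row_j Q0 i j) ord0] = p.@[Q0 i].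
  by apply: meval_eq => j; rewrite mxE.
exists r, (fun i => \row_j Q0 i j); split.
- rewrite rE e_along_rev map_rev degrees_zip; congr (hilbert _ _ _).
  by rewrite -addn1 PoszD addrK.
- move=> i i' Qii'; have [c cQ] := Q0int (fun j => (j == i)%:R).
  have := cQ i'; rewrite -QE -Qii' QE cQ eqxx.
  by case: eqVneq => // _ /eqP; rewrite oner_eq0.
- by move=> i p pf; rewrite QE; apply: Q0S.
move=> q; have [c cQ] := Q0int q.
exists (\sum_j c j *: b`_j) => [|i]; last by rewrite QE.
have sum_below (F : 'I_r -> {mpoly R[i][n]}) :
    (forall j, below m.+1 (F j)) -> below m.+1 (\sum_j F j).
  move=> Fb; apply: (big_ind (below m.+1)) => [|x y|j _] //.
    by rewrite /below msize0.
  exact: msizeD_bound.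
apply: sum_below => j; apply: leq_trans (msizeZ_le _ _) _.
by apply: bW; rewrite mem_nth // br.
Qed.
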